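(* Let $\alpha=[a_0;a_1,a_2,\dots]$ be irrational with convergent denominators $q_k$, and assume $\frac{\log a_k}{a_{k+1}} \le T$ for all $k \ge k_0$ with some constants $k_0,T\ge 1$. Let $N^*=\sum_{k=0}^{K-1} \lfloor (5/6)a_{k+1}\rfloor q_k$. Then \[ \log P_{N^*} (\alpha ) = \frac{\mathrm{Vol}(4_1)}{4 \pi} \sum_{k=1}^{K} a_k + \frac{1}{2} \sum_{k=1}^{K} \log a_k + O_T \left( \sum_{k=1}^{K} \frac{1 +\log (a_k a_{k+1})}{a_{k+1}} \right) +O_{\alpha} (1) . \]
   Context: $P_N(\alpha)=\prod_{n=1}^N |2\sin(\pi n\alpha)|$. $\mathrm{Vol}(4_1)=4\pi\int_0^{5/6}\log(2\sin(\pi x))\,\mathrm{d}x\approx 2.02988$ (the hyperbolic volume of the figure-eight knot complement). The $q_k$ are the denominators of the convergents $[a_0;a_1,\dots,a_k]$, $q_0=1$, $q_1=a_1$, $q_{k+1}=a_{k+1}q_k+q_{k-1}$. $O_T$: implied constant depending only on $T$; $O_\alpha$: implied constant that may depend on $\alpha$ (including $k_0,T$) but not on $K$. *)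

(* Defs.v *)
From Stdlib Require Import Reals ZArith Arith.
From Coquelicot Require Import Coquelicot.
Open Scope R_scope.

Definition fracR (x : R) : R := x - IZR (Int_part x).

Fixpoint cf_rem (x : R) (k : nat) : R :=
  match k with
  | O => fracR x
  | S k' => fracR (/ cf_rem x k')
  end.

(* partial quotients a_k (k >= 1) as natural numbers: a_{k+1} = floor (1 / r_k).
   a_0 = floor x is stored via Z.to_nat; it is never used below. *)
Definition cf_a (x : R) (k : nat) : nat :=
  match k with
  | O => Z.to_nat (Int_part x)
  | S k' => Z.to_nat (Int_part (/ cf_rem x k'))
  end.

Fixpoint cf_q_pair (x : R) (k : nat) : nat * nat :=
  match k with
  | O => (1%nat, cf_a x 1)
  | S k' => let (u, v) := cf_q_pair x k' in (v, (cf_a x (S (S k')) * v + u)%nat)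
  end.

Definition cf_q (x : R) (k : nat) : nat := fst (cf_q_pair x k).

Fixpoint P (alpha : R) (N : nat) : R :=
  match N with
  | O => 1
  | S n => P alpha n * Rabs (2 * sin (PI * INR (S n) * alpha))
  end.

Definition Vol41 : R :=
  4 * PI * RInt_gen (fun x => ln (2 * sin (PI * x))) (at_right 0) (at_point (5/6)).

Definition irrational (x : R) : Prop :=
  forall p q : Z, q <> 0%Z -> x <> IZR p / IZR q.

Fixpoint sumR (m n : nat) (f : nat -> R) : R :=
  match n with
  | O => 0
  | S n' => if (m <=? n')%nat then sumR m n' f + f n' else 0
  end.

(* N^* = sum_{k=0}^{K-1} floor((5/6) a_{k+1}) q_k ; floor((5/6)a) = (5a)/6 for a : nat *)
Fixpoint Nstar (x : R) (K : nat) : nat :=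
  match K with
  | O => O
  | S K' => (Nstar x K' + (5 * cf_a x (S K') / 6) * cf_q x K')%nat
  end.

(* Main.v *)
(** For irrational [alpha] in [(0, 1)] the ratio of [P alpha n] and [P (1/alpha) m] is
    [exp (G (n alpha - m + alpha) - G alpha)], where [G] is the logarithm of the double sine function:
    [G (z + alpha) - G z = ln (2 sin (pi z))], [G (z + 1) - G z = ln (2 sin (pi z / alpha))],
    [G (1 + alpha - z) = - G z], and [G] is concave to the right of its centre [(1 + alpha) / 2].
    Letting [z -> 0] in the two functional equations gives [G alpha = - ln (1/alpha) / 2]; concavity and the
    midpoint rule give [G (x + alpha) = (1/alpha) * int_{1/2}^{5/6} ln (2 sin (pi t)) dt + O(alpha)] for
    [x = 5/6 + O(alpha)]. The infinite double product for [G] is replaced by finite truncations satisfying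
    the functional equations up to a uniform error [eta], which is sent to [0] at the end.

    If [N_s] denotes the analogue of [N^*] for the [s]-th remainder [r_s] of [alpha], then
    [N_s r_s - N_(s+1) = 5/6 + O(r_s)], so iterating the reciprocity along the Gauss map gives
    [Vol(4_1)/(4 pi) * a_(s+1) + ln a_(s+1) / 2 + O(1/a_(s+1) + 1/a_(s+2))] at each level. *)

Require Import Defs.
From Stdlib Require Import Reals ZArith Arith Lra Lia.
From Coquelicot Require Import Coquelicot.
Open Scope R_scope.

(** * Finite sums and Stirling-type estimates *)

Lemma sumR_S (n : nat) (f : nat -> R) : sumR 0 (S n) f = sumR 0 n f + f n.
Proof. reflexivity. Qed.

Lemma sumR_ext (n : nat) (f g : nat -> R) :
  (forall k, (k < n)%nat -> f k = g k) -> sumR 0 n f = sumR 0 n g.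
Proof.
  induction n as [|n IH]; intros H; [reflexivity|].
  rewrite !sumR_S, IH, H; auto.
Qed.

Lemma sumR_plus (n : nat) (f g : nat -> R) :
  sumR 0 n (fun k => f k + g k) = sumR 0 n f + sumR 0 n g.
Proof. induction n as [|n IH]; [cbn; ring|rewrite !sumR_S, IH; ring]. Qed.

Lemma sumR_minus (n : nat) (f g : nat -> R) :
  sumR 0 n (fun k => f k - g k) = sumR 0 n f - sumR 0 n g.
Proof. induction n as [|n IH]; [cbn; ring|rewrite !sumR_S, IH; ring]. Qed.

Lemma sumR_scal (n : nat) (c : R) (f : nat -> R) :
  sumR 0 n (fun k => c * f k) = c * sumR 0 n f.
Proof. induction n as [|n IH]; [cbn; ring|rewrite !sumR_S, IH; ring]. Qed.

Lemma sumR_le (n : nat) (f g : nat -> R) :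
  (forall k, (k < n)%nat -> f k <= g k) -> sumR 0 n f <= sumR 0 n g.
Proof.
  induction n as [|n IH]; intros H; [cbn; lra|].
  rewrite !sumR_S.
  assert (f n <= g n) by auto.
  assert (sumR 0 n f <= sumR 0 n g) by auto.
  lra.
Qed.

Lemma sumR_const (n : nat) (c : R) : sumR 0 n (fun _ => c) = INR n * c.
Proof.
  induction n as [|n IH]; [cbn; ring|rewrite sumR_S, IH, S_INR; ring].
Qed.

Lemma sumR_Rabs_le (n : nat) (f : nat -> R) (c : R) :
  (forall k, (k < n)%nat -> Rabs (f k) <= c) -> Rabs (sumR 0 n f) <= INR n * c.
Proof.
  induction n as [|n IH]; intros H.
  - cbn; rewrite Rabs_R0; lra.
  - rewrite sumR_S, S_INR.
    eapply Rle_trans; [apply Rabs_triang|].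
    assert (Rabs (f n) <= c) by auto.
    assert (Rabs (sumR 0 n f) <= INR n * c) by auto.
    lra.
Qed.

Lemma sumR_telescope (n : nat) (f : nat -> R) :
  sumR 0 n (fun k => f (S k) - f k) = f n - f O.
Proof. induction n as [|n IH]; [cbn; ring|rewrite sumR_S, IH; ring]. Qed.

Lemma sumR_swap (m n : nat) (f : nat -> nat -> R) :
  sumR 0 m (fun i => sumR 0 n (fun j => f i j))
  = sumR 0 n (fun j => sumR 0 m (fun i => f i j)).
Proof.
  induction m as [|m IH].
  - cbn. rewrite sumR_const. ring.
  - rewrite sumR_S, IH, <- sumR_plus. apply sumR_ext. intros; now rewrite sumR_S.
Qed.

Lemma sumR_cat (m n : nat) (f : nat -> R) :
  sumR 0 (m + n) f = sumR 0 m f + sumR 0 n (fun k => f (m + k)%nat).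
Proof.
  induction n as [|n IH].
  - rewrite Nat.add_0_r. cbn; ring.
  - rewrite Nat.add_succ_r, !sumR_S, IH. ring.
Qed.

Lemma sumR_first (n : nat) (f : nat -> R) :
  sumR 0 (S n) f = f O + sumR 0 n (fun k => f (S k)).
Proof. induction n as [|n IH]; [cbn; ring|rewrite sumR_S, IH, sumR_S; ring]. Qed.

Lemma sumR_rev (n : nat) (f : nat -> R) :
  sumR 0 n f = sumR 0 n (fun k => f (n - 1 - k)%nat).
Proof.
  induction n as [|n IH]; [reflexivity|].
  rewrite (sumR_first n (fun k => f (S n - 1 - k)%nat)), sumR_S, IH, Rplus_comm.
  f_equal; [f_equal; lia|].
  apply sumR_ext; intros k Hk; f_equal; lia.
Qed.

Lemma sumR_fold (n : nat) (f : nat -> R) :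
  sumR 0 (2 * n) f = sumR 0 n (fun k => f k + f (2 * n - 1 - k)%nat).
Proof.
  replace (2 * n)%nat with (n + n)%nat by lia.
  rewrite sumR_cat, sumR_plus. f_equal.
  rewrite sumR_rev. apply sumR_ext; intros k Hk; f_equal; lia.
Qed.

Lemma sumR_1_S (n : nat) (f : nat -> R) : sumR 1 (S n) f = sumR 0 n (fun k => f (S k)).
Proof.
  induction n as [|n IH]; [reflexivity|].
  change (sumR 1 (S (S n)) f) with (sumR 1 (S n) f + f (S n)).
  now rewrite IH, sumR_S.
Qed.

Lemma nonneg_le_of_derive (h h' : R -> R) (x : R) :
  0 <= x -> h 0 = 0 ->
  (forall t, 0 <= t <= x -> is_derive h t (h' t)) ->
  (forall t, 0 <= t <= x -> 0 <= h' t) -> 0 <= h x.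
Proof.
  intros Hx H0 Hd Hp.
  destruct (MVT_gen h 0 x h') as [c [Hc1 Hc2]].
  - intros t; rewrite Rmin_left, Rmax_right by lra; intros; apply Hd; lra.
  - intros t; rewrite Rmin_left, Rmax_right by lra; intros.
    apply derivable_continuous_pt. exists (h' t). apply is_derive_Reals, Hd; lra.
  - rewrite Rmin_left, Rmax_right in Hc1 by lra.
    assert (0 <= h' c) by (apply Hp; lra). nra.
Qed.

Lemma ln1p_le (t : R) : -1 < t -> ln (1 + t) <= t.
Proof.
  intros H. destruct (Req_dec t 0) as [->|Hn].
  - rewrite Rplus_0_r, ln_1; lra.
  - rewrite <- (ln_exp t) at 2.
    apply ln_le; [lra|]. apply exp_ineq1_le.
Qed.

Lemma ln1p_ge_quad (t : R) : 0 <= t -> t - t ^ 2 / 2 <= ln (1 + t).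
Proof.
  intros H.
  enough (0 <= (fun t => ln (1 + t) - (t - t ^ 2 / 2)) t) by (cbv beta in *; lra).
  apply (nonneg_le_of_derive (fun t => ln (1 + t) - (t - t ^ 2 / 2)) (fun t => t ^ 2 / (1 + t))); cbv beta.
  - lra.
  - rewrite Rplus_0_r, ln_1; field.
  - intros u Hu. auto_derive; [lra|field; lra].
  - intros u Hu. apply Rdiv_le_0_compat; [nra|lra].
Qed.

Lemma ln1p_le_cube (t : R) : 0 <= t -> ln (1 + t) <= t - t ^ 2 / 2 + t ^ 3 / 3.
Proof.
  intros H.
  enough (0 <= (fun t => t - t ^ 2 / 2 + t ^ 3 / 3 - ln (1 + t)) t) by (cbv beta in *; lra).
  apply (nonneg_le_of_derive (fun t => t - t ^ 2 / 2 + t ^ 3 / 3 - ln (1 + t)) (fun t => t ^ 3 / (1 + t))); cbv beta.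
  - lra.
  - rewrite Rplus_0_r, ln_1; field.
  - intros u Hu. auto_derive; [lra|field; lra].
  - intros u Hu. apply Rdiv_le_0_compat; [apply pow_le; lra|lra].
Qed.

Lemma ln1m_ge (t : R) : 0 <= t <= / 2 -> - (2 * t) <= ln (1 - t).
Proof.
  intros H.
  enough (0 <= (fun t => ln (1 - t) + 2 * t) t) by (cbv beta in *; lra).
  apply (nonneg_le_of_derive (fun t => ln (1 - t) + 2 * t) (fun t => (1 - 2 * t) / (1 - t))); cbv beta.
  - lra.
  - rewrite Rminus_0_r, ln_1; field.
  - intros u Hu. auto_derive; [lra|field; lra].
  - intros u Hu. apply Rdiv_le_0_compat; lra.
Qed.

Definition Lam (u : R) : R := u * ln u - u.

(* [Lam (u + 1) - Lam u] is the integral of [ln] over [[u, u + 1]]. *)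
Lemma ln_sym_nodes (u z : R) : 1 <= u -> 0 <= z <= 1 ->
  Rabs (ln (u + z) + ln (u + (1 - z)) - 2 * (Lam (u + 1) - Lam u)) <= 2 / u ^ 2.
Proof.
  intros Hu Hz. set (v := / u).
  assert (Hv : 0 < v <= 1).
  { unfold v; split; [apply Rinv_0_lt_compat; lra|].
    rewrite <- Rinv_1. apply Rinv_le_contravar; lra. }
  assert (Hs : forall s, 0 <= s -> ln (u + s) = ln u + ln (1 + s * v)).
  { intros s Hs. rewrite <- ln_mult; [|lra|nra]. f_equal. unfold v; field; lra. }
  unfold Lam. rewrite !Hs by lra.
  assert (Hu' : u = / v) by (unfold v; now rewrite Rinv_inv).
  replace (2 / u ^ 2) with (2 * v ^ 2) by (unfold v; field; lra).
  assert (B1 := ln1p_ge_quad (z * v) ltac:(nra)).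
  assert (B2 := ln1p_le (z * v) ltac:(nra)).
  assert (B3 := ln1p_ge_quad ((1 - z) * v) ltac:(nra)).
  assert (B4 := ln1p_le ((1 - z) * v) ltac:(nra)).
  assert (B5 := ln1p_ge_quad (1 * v) ltac:(nra)).
  assert (B6 := ln1p_le_cube (1 * v) ltac:(nra)).
  rewrite Rmult_1_l in *.
  replace (ln u + ln (1 + z * v) + (ln u + ln (1 + (1 - z) * v)) -
    2 * ((u + 1) * (ln u + ln (1 + v)) - (u + 1) - (u * ln u - u)))
    with (ln (1 + z * v) + ln (1 + (1 - z) * v) - 2 * ((u + 1) * ln (1 + v)) + 2) by ring.
  set (l := ln (1 + v)) in *.
  assert (C1 : (u + 1) * (v - v ^ 2 / 2) <= (u + 1) * l) by (apply Rmult_le_compat_l; lra).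
  assert (C2 : (u + 1) * l <= (u + 1) * (v - v ^ 2 / 2 + v ^ 3 / 3))
    by (apply Rmult_le_compat_l; lra).
  replace ((u + 1) * (v - v ^ 2 / 2)) with (1 + v / 2 - v ^ 2 / 2) in C1
    by (rewrite Hu'; field; lra).
  replace ((u + 1) * (v - v ^ 2 / 2 + v ^ 3 / 3)) with (1 + v / 2 - v ^ 2 / 6 + v ^ 3 / 3) in C2
    by (rewrite Hu'; field; lra).
  assert (v ^ 3 <= v ^ 2) by nra.
  assert ((z * v) ^ 2 + ((1 - z) * v) ^ 2 <= v ^ 2).
  { replace ((z * v) ^ 2 + ((1 - z) * v) ^ 2) with ((z ^ 2 + (1 - z) ^ 2) * v ^ 2) by ring.
    assert (z ^ 2 + (1 - z) ^ 2 <= 1) by nra.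
    assert (0 <= v ^ 2) by nra. nra. }
  apply Rabs_le. lra.
Qed.

Lemma ln_sum_shifted (n : nat) (T z : R) : 1 <= T -> 0 <= z <= 1 ->
  Rabs (sumR 0 n (fun m => ln (z + INR m + T) + ln (1 - z + INR m + T))
        - 2 * (Lam (T + INR n) - Lam T)) <= INR n * (2 / T ^ 2).
Proof.
  intros HT Hz.
  replace (2 * (Lam (T + INR n) - Lam T))
    with (sumR 0 n (fun m => 2 * Lam (T + INR (S m)) - 2 * Lam (T + INR m))).
  2:{ rewrite (sumR_telescope n (fun m => 2 * Lam (T + INR m))). simpl INR.
      rewrite Rplus_0_r; ring. }
  rewrite <- sumR_minus. apply sumR_Rabs_le. intros m _.
  assert (Hm := pos_INR m).
  assert (B := ln_sym_nodes (T + INR m) z ltac:(lra) Hz).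
  rewrite S_INR.
  replace (z + INR m + T) with (T + INR m + z) by ring.
  replace (1 - z + INR m + T) with (T + INR m + (1 - z)) by ring.
  replace (T + (INR m + 1)) with (T + INR m + 1) by ring.
  rewrite <- Rmult_minus_distr_l.
  eapply Rle_trans; [exact B|].
  apply Rmult_le_compat_l; [lra|].
  apply Rinv_le_contravar; [apply pow_lt; lra|].
  apply pow_incr; lra.
Qed.

Lemma Lam_double (u : R) : 0 < u -> Lam (2 * u) = 2 * u * ln 2 + 2 * Lam u.
Proof. intros H. unfold Lam. rewrite ln_mult by lra. ring. Qed.

(* [ln (2n)! = 2 n ln 2 + sum ln (m + 1/2) + ln n!] makes the unknown constant of Stirling's formula cancel. *)
Lemma ln_half_integers_sum (n : nat) : (1 <= n)%nat ->
  Rabs (sumR 0 n (fun m => ln (INR m + / 2)) - Lam (INR n) - / 2 * ln 2) <= / INR n.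
Proof.
  intros Hn.
  assert (Hn0 : 1 <= INR n) by (now apply (le_INR 1)).
  set (t := fun k : nat => sumR 0 k (fun j => ln (INR (S j))) - Lam (INR k) - / 2 * ln (INR k)).
  assert (Ht : forall k, (1 <= k)%nat -> Rabs (t (S k) - t k) <= / (INR k) ^ 2).
  { intros k Hk. assert (1 <= INR k) by (now apply (le_INR 1)).
    assert (B := ln_sym_nodes (INR k) 0 ltac:(lra) ltac:(lra)).
    unfold t. rewrite sumR_S, S_INR.
    rewrite Rplus_0_r, Rminus_0_r in B.
    match goal with |- Rabs ?a <= _ =>
      replace a with (/ 2 * (ln (INR k) + ln (INR k + 1) - 2 * (Lam (INR k + 1) - Lam (INR k))))
        by field end.
    rewrite Rabs_mult, (Rabs_pos_eq (/ 2)) by lra.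
    unfold Rdiv in B. lra. }
  assert (Hd : forall j, Rabs (t (n + j)%nat - t n) <= INR j * / (INR n) ^ 2).
  { induction j as [|j IH].
    - rewrite Nat.add_0_r, Rminus_diag, Rabs_R0. simpl; lra.
    - rewrite Nat.add_succ_r, S_INR.
      replace (t (S (n + j)) - t n) with ((t (S (n + j)) - t (n + j)%nat) + (t (n + j)%nat - t n)) by ring.
      eapply Rle_trans; [apply Rabs_triang|].
      assert (B := Ht (n + j)%nat ltac:(lia)).
      assert (/ INR (n + j) ^ 2 <= / INR n ^ 2); [|lra].
      apply Rinv_le_contravar; [apply pow_lt; lra|].
      apply pow_incr; split; [lra|apply le_INR; lia]. }
  assert (Hs : forall k, sumR 0 (k + k) (fun j => ln (INR (S j)))
     = 2 * INR k * ln 2 + sumR 0 k (fun m => ln (INR m + / 2)) + sumR 0 k (fun j => ln (INR (S j)))).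
  { induction k as [|k IH]; [cbn; ring|].
    replace (S k + S k)%nat with (S (S (k + k))) by lia.
    rewrite !sumR_S, IH.
    assert (Hk := pos_INR k).
    replace (INR (S (k + k))) with (2 * (INR k + / 2)) by (rewrite S_INR, plus_INR; field).
    replace (INR (S (S (k + k)))) with (2 * (INR k + 1)) by (rewrite !S_INR, plus_INR; field).
    rewrite !ln_mult by lra. rewrite S_INR. ring. }
  assert (E : sumR 0 n (fun m => ln (INR m + / 2)) - Lam (INR n) - / 2 * ln 2
     = t (n + n)%nat - t n).
  { unfold t. rewrite Hs, plus_INR.
    replace (INR n + INR n) with (2 * INR n) by ring.
    rewrite Lam_double by lra. rewrite (ln_mult 2) by lra. field. }
  rewrite E. eapply Rle_trans; [apply Hd|]. right; field; lra.
Qed.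

(** * The sine product *)

Lemma PI_lt_3_4 : PI < 3.4.
Proof.
  assert (H := PI_ineq 2). destruct H as [_ H]. simpl in H. unfold tg_alt, PI_tg in H; simpl in H. lra.
Qed.

Lemma PI_gt_3 : 3 < PI.
Proof. assert (H := PI2_3_2). lra. Qed.

Lemma sin_ge_cubic (t : R) : 0 <= t -> t - t ^ 3 / 6 <= sin t.
Proof.
  intros Ht.
  assert (Hsin : forall u, 0 <= u -> sin u <= u).
  { intros u Hu. destruct (Req_dec u 0) as [->|]; [rewrite sin_0; lra|].
    left; apply sin_lt_x; lra. }
  assert (Hcos : forall u, 0 <= u -> 0 <= cos u - 1 + u ^ 2 / 2).
  { intros u Hu.
    apply (nonneg_le_of_derive (fun u => cos u - 1 + u ^ 2 / 2) (fun u => u - sin u)); auto.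
    - rewrite cos_0; field.
    - intros v Hv. auto_derive; [auto|field].
    - intros v Hv. specialize (Hsin v ltac:(lra)); lra. }
  enough (0 <= (fun t => sin t - t + t ^ 3 / 6) t) by (cbv beta in *; lra).
  apply (nonneg_le_of_derive (fun t => sin t - t + t ^ 3 / 6) (fun u => cos u - 1 + u ^ 2 / 2)); auto.
  - rewrite sin_0; field.
  - intros v Hv. auto_derive; [auto|field].
  - intros v Hv; apply Hcos; lra.
Qed.

Lemma sin_ge_half (t : R) : 0 <= t <= PI / 2 -> t / 2 <= sin t.
Proof.
  intros Ht. assert (H := sin_ge_cubic t ltac:(lra)).
  assert (H' := PI_lt_3_4). assert (t ^ 2 <= 3) by nra. nra.
Qed.

Lemma sin_sq_le (x : R) : sin x ^ 2 <= x ^ 2.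
Proof.
  assert (H : forall y, 0 <= y -> sin y ^ 2 <= y ^ 2).
  { intros y Hy. assert (B := SIN_bound y). destruct (Rle_dec y 1) as [H1|H1]; [|nra].
    assert (L := sin_ge_cubic y Hy). assert (y ^ 3 <= y) by nra.
    destruct (Req_dec y 0) as [->|]; [rewrite sin_0; lra|].
    assert (sin y < y) by (apply sin_lt_x; lra). nra. }
  destruct (Rle_dec 0 x) as [Hx|Hx]; [auto|].
  specialize (H (- x) ltac:(lra)). rewrite sin_neg in H. nra.
Qed.

Lemma ln_sin_near (t : R) : 0 < t <= 1 -> Rabs (ln (sin t) - ln t) <= t ^ 2.
Proof.
  intros Ht.
  assert (H1 := sin_ge_cubic t ltac:(lra)).
  assert (H2 : sin t < t) by (apply sin_lt_x; lra).
  assert (Hp : 0 < t * (1 - t ^ 2 / 6)) by nra.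
  assert (L1 : ln (sin t) <= ln t) by (apply ln_le; nra).
  assert (L2 : ln (t * (1 - t ^ 2 / 6)) <= ln (sin t)) by (apply ln_le; nra).
  rewrite ln_mult in L2 by nra.
  assert (L3 := ln1m_ge (t ^ 2 / 6) ltac:(nra)).
  apply Rabs_le; nra.
Qed.

Definition lsin (x : R) : R := ln (2 * sin (PI * x)).

Lemma sin_PI_pos (x : R) : 0 < x < 1 -> 0 < sin (PI * x).
Proof. intros H. assert (P := PI_RGT_0). apply sin_gt_0; nra. Qed.

Lemma lsin_sym (x : R) : lsin (1 - x) = lsin x.
Proof.
  unfold lsin. replace (PI * (1 - x)) with (PI - PI * x) by ring.
  now rewrite sin_PI_x.
Qed.

Lemma lsin_half : lsin (/ 2) = ln 2.
Proof.
  unfold lsin. replace (PI * / 2) with (PI / 2) by field. rewrite sin_PI2. f_equal; ring.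
Qed.

Lemma lsin_5_6 : lsin (5 / 6) = 0.
Proof.
  rewrite <- lsin_sym. unfold lsin.
  replace (PI * (1 - 5 / 6)) with (PI / 6) by field.
  rewrite sin_PI6. replace (2 * (1 / 2)) with 1 by field. apply ln_1.
Qed.

Lemma lsin_double (t : R) : 0 < t < 1 -> lsin t = lsin (t / 2) + lsin (1 / 2 - t / 2).
Proof.
  intros Ht. unfold lsin.
  assert (H1 := sin_PI_pos (t / 2) ltac:(lra)).
  assert (H2 := sin_PI_pos (1 / 2 - t / 2) ltac:(lra)).
  rewrite <- ln_mult by lra. f_equal.
  replace (PI * t) with (2 * (PI * (t / 2))) by field.
  rewrite sin_2a.
  replace (PI * (1 / 2 - t / 2)) with (PI / 2 - PI * (t / 2)) by field.
  rewrite sin_shift. ring.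
Qed.

Lemma lsin_eq_sum (z : R) (k : nat) : 0 < z < 1 ->
  lsin z = sumR 0 (2 ^ k) (fun r => lsin ((z + INR r) / (2 * INR (2 ^ k)))
                                    + lsin ((1 - z + INR r) / (2 * INR (2 ^ k)))).
Proof.
  intros Hz. induction k as [|k IH].
  - cbn. rewrite lsin_double by lra.
    rewrite Rplus_0_l, !Rplus_0_r, Rmult_1_r. f_equal. f_equal. field.
  - rewrite IH. change (2 ^ S k)%nat with (2 * 2 ^ k)%nat. rewrite sumR_fold.
    set (Q := (2 ^ k)%nat). apply sumR_ext. intros r Hr.
    assert (HQ : 0 < INR Q) by (apply lt_0_INR; lia).
    assert (Hr' : INR r + 1 <= INR Q) by (rewrite <- S_INR; apply le_INR; lia).
    assert (Hr0 := pos_INR r).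
    assert (E : INR (2 * Q - 1 - r) = 2 * INR Q - 1 - INR r).
    { rewrite !minus_INR, mult_INR by lia. simpl; ring. }
    assert (Hb : forall w, 0 < w < 1 -> 0 < (w + INR r) / (2 * INR Q) < 1).
    { intros w Hw. split; [apply Rdiv_lt_0_compat; lra|].
      apply Rlt_div_l; lra. }
    rewrite (lsin_double ((z + INR r) / (2 * INR Q))), (lsin_double ((1 - z + INR r) / (2 * INR Q)))
      by (apply Hb; lra).
    rewrite E, mult_INR. change (INR 2) with 2.
    replace (1 / 2 - (z + INR r) / (2 * INR Q) / 2)
      with ((1 - z + (2 * INR Q - 1 - INR r)) / (2 * (2 * INR Q))) by (field; lra).
    replace (1 / 2 - (1 - z + INR r) / (2 * INR Q) / 2)
      with ((z + (2 * INR Q - 1 - INR r)) / (2 * (2 * INR Q))) by (field; lra).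
    replace ((z + INR r) / (2 * INR Q) / 2) with ((z + INR r) / (2 * (2 * INR Q))) by (field; lra).
    replace ((1 - z + INR r) / (2 * INR Q) / 2) with ((1 - z + INR r) / (2 * (2 * INR Q))) by (field; lra).
    ring.
Qed.

Lemma lsin_pair_le (s d : R) : 0 < s + d < 1 -> 0 < s - d < 1 ->
  lsin (s + d) + lsin (s - d) <= 2 * lsin s.
Proof.
  intros H1 H2. unfold lsin.
  assert (P1 := sin_PI_pos _ H1). assert (P2 := sin_PI_pos _ H2).
  assert (P0 := sin_PI_pos s ltac:(lra)).
  rewrite <- ln_mult by lra.
  replace (2 * ln (2 * sin (PI * s))) with (ln ((2 * sin (PI * s)) * (2 * sin (PI * s))))
    by (rewrite ln_mult by lra; ring).
  apply ln_le; [apply Rmult_lt_0_compat; lra|].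
  replace (PI * (s + d)) with (PI * s + PI * d) by ring.
  replace (PI * (s - d)) with (PI * s - PI * d) by ring.
  rewrite sin_plus, sin_minus.
  assert (A := sin2_cos2 (PI * s)). assert (B := sin2_cos2 (PI * d)). unfold Rsqr in *. nra.
Qed.

Lemma lsin_pair_ge (s d q : R) : 0 < s + d < 1 -> 0 < s - d < 1 ->
  (sin (PI * d)) ^ 2 <= q * (sin (PI * s)) ^ 2 -> 0 <= q <= / 2 ->
  2 * lsin s - 2 * q <= lsin (s + d) + lsin (s - d).
Proof.
  intros H1 H2 Hq Hq2. unfold lsin.
  assert (P1 := sin_PI_pos _ H1). assert (P2 := sin_PI_pos _ H2).
  assert (P0 := sin_PI_pos s ltac:(lra)).
  rewrite <- ln_mult by lra.
  assert (L := ln1m_ge q Hq2).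
  apply Rle_trans with (ln ((2 * sin (PI * s)) * (2 * sin (PI * s)) * (1 - q))).
  - rewrite !ln_mult by nra. lra.
  - apply ln_le; [apply Rmult_lt_0_compat; nra|].
    replace (PI * (s + d)) with (PI * s + PI * d) by ring.
    replace (PI * (s - d)) with (PI * s - PI * d) by ring.
    rewrite sin_plus, sin_minus.
    assert (A := sin2_cos2 (PI * s)). assert (B := sin2_cos2 (PI * d)). unfold Rsqr in *. nra.
Qed.

Lemma sum_tail_inv_sq (n j : nat) : (1 <= n)%nat ->
  sumR 0 j (fun k => / (INR (n + k) + / 2) ^ 2) <= / INR n.
Proof.
  intros Hn.
  assert (H1 : 1 <= INR n) by (now apply (le_INR 1)).
  apply Rle_trans with (sumR 0 j (fun k => - / INR (n + S k) - - / INR (n + k))).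
  - apply sumR_le. intros k _.
    assert (1 <= INR (n + k)) by (apply (le_INR 1); lia).
    rewrite Nat.add_succ_r, S_INR.
    replace (- / (INR (n + k) + 1) - - / INR (n + k)) with (/ (INR (n + k) * (INR (n + k) + 1)))
      by (field; lra).
    apply Rinv_le_contravar; nra.
  - rewrite (sumR_telescope j (fun k => - / INR (n + k))), Nat.add_0_r.
    assert (0 < / INR (n + j)); [|lra].
    apply Rinv_0_lt_compat, lt_0_INR; lia.
Qed.

Lemma pow2_unbounded (X : R) : exists k : nat, X <= INR (2 ^ k).
Proof.
  destruct (INR_unbounded X) as [k Hk]. exists k.
  apply Rle_trans with (INR k); [lra|].
  apply le_INR. apply Nat.lt_le_incl, Nat.pow_gt_lin_r; lia.
Qed.

Lemma sine_product_bounds (z : R) (n k : nat) :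
  0 < z < 1 -> (1 <= n <= 2 ^ k)%nat ->
  let S := sumR 0 n (fun r => lsin ((z + INR r) / (2 * INR (2 ^ k)))
              + lsin ((1 - z + INR r) / (2 * INR (2 ^ k)))
              - 2 * lsin ((/ 2 + INR r) / (2 * INR (2 ^ k)))) in
  S - 2 / INR n <= lsin z - ln 2 <= S.
Proof.
  intros Hz Hn S.
  set (Q := (2 ^ k)%nat) in *.
  set (D := fun r : nat => lsin ((z + INR r) / (2 * INR Q)) + lsin ((1 - z + INR r) / (2 * INR Q))
              - 2 * lsin ((/ 2 + INR r) / (2 * INR Q))) in S.
  assert (HQ : 0 < INR Q) by (apply lt_0_INR; lia).
  assert (E : lsin z - ln 2 = sumR 0 Q D).
  { unfold D. rewrite sumR_minus. unfold Q. rewrite <- (lsin_eq_sum z k Hz), <- lsin_half.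
    rewrite (lsin_eq_sum (/ 2) k) by lra. f_equal.
    apply sumR_ext. intros r Hr. replace (1 - / 2) with (/ 2) by field. ring. }
  replace Q with (n + (Q - n))%nat in E by lia.
  rewrite sumR_cat in E. rewrite E. fold S.
  assert (Hb : forall r, (r < Q)%nat ->
     0 < (/ 2 + INR r) / (2 * INR Q) + (z - / 2) / (2 * INR Q) < 1 /\
     0 < (/ 2 + INR r) / (2 * INR Q) - (z - / 2) / (2 * INR Q) < 1 /\
     D r = lsin ((/ 2 + INR r) / (2 * INR Q) + (z - / 2) / (2 * INR Q))
         + lsin ((/ 2 + INR r) / (2 * INR Q) - (z - / 2) / (2 * INR Q))
         - 2 * lsin ((/ 2 + INR r) / (2 * INR Q))).
  { intros r Hr.
    assert (Hr' : INR r + 1 <= INR Q) by (rewrite <- S_INR; apply le_INR; lia).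
    assert (Hr0 := pos_INR r).
    replace ((/ 2 + INR r) / (2 * INR Q) + (z - / 2) / (2 * INR Q))
      with ((z + INR r) / (2 * INR Q)) by (field; lra).
    replace ((/ 2 + INR r) / (2 * INR Q) - (z - / 2) / (2 * INR Q))
      with ((1 - z + INR r) / (2 * INR Q)) by (field; lra).
    repeat split; try (apply Rdiv_lt_0_compat; lra); apply Rlt_div_l; lra. }
  assert (Hup : sumR 0 (Q - n) (fun j => D (n + j)%nat) <= 0).
  { apply Rle_trans with (sumR 0 (Q - n) (fun _ => 0)); [|rewrite sumR_const; lra].
    apply sumR_le. intros j Hj. destruct (Hb (n + j)%nat ltac:(lia)) as [H1 [H2 ->]].
    assert (B := lsin_pair_le _ _ H1 H2). lra. }
  assert (Hlo : - (2 / INR n) <= sumR 0 (Q - n) (fun j => D (n + j)%nat)).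
  { apply Rle_trans with (sumR 0 (Q - n) (fun j => (-2) * / (INR (n + j) + / 2) ^ 2)).
    - rewrite sumR_scal. assert (B := sum_tail_inv_sq n (Q - n) ltac:(lia)).
      unfold Rdiv; lra.
    - apply sumR_le. intros j Hj.
      destruct (Hb (n + j)%nat ltac:(lia)) as [H1 [H2 ->]].
      set (r := (n + j)%nat) in *.
      assert (Hr1 : 1 <= INR r) by (apply (le_INR 1); lia).
      assert (Hr' : INR r + 1 <= INR Q) by (rewrite <- S_INR; apply le_INR; lia).
      assert (Hq : / (INR r + / 2) ^ 2 <= / 2) by (apply Rinv_le_contravar; nra).
      assert (Hq0 : 0 < / (INR r + / 2) ^ 2) by (apply Rinv_0_lt_compat; nra).
      assert (B := lsin_pair_ge _ _ (/ (INR r + / 2) ^ 2) H1 H2).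
      cut (sin (PI * ((z - / 2) / (2 * INR Q))) ^ 2
        <= / (INR r + / 2) ^ 2 * sin (PI * ((/ 2 + INR r) / (2 * INR Q))) ^ 2); [intro; lra|].
      assert (HP := PI_RGT_0).
      set (e := PI / (2 * INR Q)).
      assert (He : 0 < e) by (apply Rdiv_lt_0_compat; lra).
      replace (PI * ((z - / 2) / (2 * INR Q))) with (e * (z - / 2)) by (unfold e; field; lra).
      replace (PI * ((/ 2 + INR r) / (2 * INR Q))) with (e * (INR r + / 2)) by (unfold e; field; lra).
      assert (Hs : e * (INR r + / 2) / 2 <= sin (e * (INR r + / 2))).
      { apply sin_ge_half. split; [nra|].
        apply Rle_trans with (e * INR Q); [apply Rmult_le_compat_l; lra|].
        unfold e. right; field; lra. }
      assert (Hsd : sin (e * (z - / 2)) ^ 2 <= (e * (z - / 2)) ^ 2)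
        by apply sin_sq_le.
      assert (Hz2 : (e * (z - / 2)) ^ 2 <= e ^ 2 / 4).
      { rewrite Rpow_mult_distr. assert ((z - / 2) ^ 2 <= / 4) by nra.
        assert (0 <= e ^ 2) by nra. nra. }
      assert (Hs2 : (e * (INR r + / 2) / 2) ^ 2 <= sin (e * (INR r + / 2)) ^ 2).
      { apply pow_incr. split; [nra|exact Hs]. }
      apply Rle_trans with (/ (INR r + / 2) ^ 2 * (e * (INR r + / 2) / 2) ^ 2).
      + replace (/ (INR r + / 2) ^ 2 * (e * (INR r + / 2) / 2) ^ 2) with (e ^ 2 / 4); [lra|].
        field. nra.
      + apply Rmult_le_compat_l; lra. }
  lra.
Qed.

Lemma sine_product (z : R) (n : nat) : 0 < z < 1 -> (1 <= n)%nat ->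
  Rabs (sumR 0 n (fun m => ln (z + INR m) + ln (1 - z + INR m) - 2 * ln (INR m + / 2))
        - (lsin z - ln 2)) <= 2 / INR n.
Proof.
  intros Hz Hn.
  assert (Hn1 : 1 <= INR n) by (now apply (le_INR 1)).
  apply le_epsilon. intros eps Heps.
  set (X := 16 * INR n ^ 3 / eps).
  assert (HX : 0 < X) by (apply Rdiv_lt_0_compat; [assert (0 < INR n ^ 3) by (apply pow_lt; lra)|]; lra).
  destruct (pow2_unbounded (2 * INR n + X)) as [k Hk].
  assert (HnQ : (n <= 2 ^ k)%nat) by (apply INR_le; lra).
  assert (B := sine_product_bounds z n k Hz (conj Hn HnQ)). cbv zeta in B.
  set (Q := INR (2 ^ k)) in *.
  set (S1 := sumR 0 n _) in B. set (S2 := sumR 0 n _).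
  assert (Hd : Rabs (S1 - S2) <= eps).
  { unfold S1, S2. rewrite <- sumR_minus.
    apply Rle_trans with (INR n * (16 * (INR n / Q) ^ 2)).
    - apply sumR_Rabs_le. intros r Hr.
      assert (Hr0 := pos_INR r).
      assert (Hr1 : INR r + 1 <= INR n) by (rewrite <- S_INR; apply le_INR; lia).
      assert (HP := PI_gt_3). assert (HP4 := PI_4).
      assert (Hw : forall w, 0 < w < 1 ->
        Rabs (lsin ((w + INR r) / (2 * Q)) - (ln (PI / Q) + ln (w + INR r))) <= 4 * (INR n / Q) ^ 2).
      { intros w Hw. unfold lsin.
        replace (PI * ((w + INR r) / (2 * Q))) with (PI / Q / 2 * (w + INR r)) by (field; lra).
        set (e := PI / Q).
        assert (He : 0 < e) by (apply Rdiv_lt_0_compat; lra).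
        assert (He4 : e * Q <= 4) by (unfold e; field_simplify; lra).
        assert (Ht : 0 < e / 2 * (w + INR r) <= 2 * (INR n / Q)).
        { split; [nra|].
          apply Rle_trans with (e / 2 * INR n); [apply Rmult_le_compat_l; lra|].
          assert (He' : e <= 4 / Q) by
            (apply Rmult_le_compat_r; [left; apply Rinv_0_lt_compat; lra|lra]).
          apply Rle_trans with (4 / Q / 2 * INR n); [apply Rmult_le_compat_r; lra|].
          right; field; lra. }
        assert (HQ1 : INR n / Q <= / 2) by (apply Rle_div_l; lra).
        assert (Hnear := ln_sin_near (e / 2 * (w + INR r)) ltac:(lra)).
        assert (Hsin : 0 < sin (e / 2 * (w + INR r))) by (apply sin_gt_0; lra).
        rewrite ln_mult by lra.
        rewrite ln_mult in Hnear by lra.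
        replace (ln e) with (ln 2 + ln (e / 2)) by (rewrite <- ln_mult by lra; f_equal; field).
        match goal with |- Rabs ?a <= _ =>
          replace a with (ln (sin (e / 2 * (w + INR r))) - (ln (e / 2) + ln (w + INR r))) by ring end.
        eapply Rle_trans; [exact Hnear|].
        replace (4 * (INR n / Q) ^ 2) with ((2 * (INR n / Q)) ^ 2) by ring.
        apply pow_incr; lra. }
      assert (B1 := Hw z Hz). assert (B2 := Hw (1 - z) ltac:(lra)). assert (B3 := Hw (/ 2) ltac:(lra)).
      rewrite (Rplus_comm (INR r) (/ 2)).
      apply Rabs_le_between in B1, B2, B3. apply Rabs_le. lra.
    - apply Rle_trans with (16 * INR n ^ 3 / Q).
      + unfold Rdiv. rewrite Rpow_mult_distr.
        assert (/ Q <= 1) by (rewrite <- Rinv_1; apply Rinv_le_contravar; lra).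
        assert (0 < / Q) by (apply Rinv_0_lt_compat; lra).
        assert (0 < INR n ^ 3) by (apply pow_lt; lra).
        replace (INR n * (16 * (INR n ^ 2 * (/ Q) ^ 2))) with (16 * INR n ^ 3 * (/ Q * / Q)) by ring.
        apply Rmult_le_compat_l; nra.
      + apply Rle_div_l; [lra|].
        replace (16 * INR n ^ 3) with (eps * X) by (unfold X; field; lra).
        apply Rmult_le_compat_l; lra. }
  apply Rabs_le_between in Hd.
  assert (0 < 2 / INR n) by (apply Rdiv_lt_0_compat; lra).
  apply Rabs_le. lra.
Qed.

(** * Truncated double sine functions *)

Lemma lsin_column (z tau : R) (n : nat) :
  0 < z < 1 -> 0 < tau -> (1 <= n)%nat -> 1 <= INR n * tau ->
  Rabs (sumR 0 n (fun m => ln (z + INR m) + ln (1 - z + INR m)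
          - (ln (z + INR m + INR n * tau) + ln (1 - z + INR m + INR n * tau)))
        + 2 * (Lam (INR n + INR n * tau) - Lam (INR n) - Lam (INR n * tau)) - lsin z)
  <= (4 + 2 / tau ^ 2) / INR n.
Proof.
  intros Hz Ht Hn HT.
  assert (Hn1 : 1 <= INR n) by (now apply (le_INR 1)).
  assert (B1 := sine_product z n Hz Hn).
  assert (B2 := ln_half_integers_sum n Hn).
  assert (B3 := ln_sum_shifted n (INR n * tau) z HT ltac:(lra)).
  rewrite sumR_minus.
  rewrite sumR_minus, sumR_scal in B1.
  replace (INR n * (2 / (INR n * tau) ^ 2)) with (2 / tau ^ 2 / INR n) in B3 by (field; lra).
  rewrite (Rplus_comm (INR n) (INR n * tau)).
  replace ((4 + 2 / tau ^ 2) / INR n) with (2 * (2 / INR n) + 2 / tau ^ 2 / INR n) by (field; lra).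
  apply Rabs_le_between in B1, B2, B3. apply Rabs_le. unfold Rdiv in *. lra.
Qed.

Definition concave_on (a b : R) (g : R -> R) : Prop :=
  forall u v w, a <= u -> u < v -> v < w -> w < b ->
    (g w - g v) * (v - u) <= (g v - g u) * (w - v).

Lemma concave_on_sumR (a b : R) (n : nat) (f : nat -> R -> R) :
  (forall k, concave_on a b (f k)) -> concave_on a b (fun z => sumR 0 n (fun k => f k z)).
Proof.
  intros H u v w Hu Huv Hvw Hw. induction n as [|n IH]; [cbn; lra|].
  rewrite !sumR_S. specialize (H n u v w Hu Huv Hvw Hw). lra.
Qed.

Lemma concave_on_of_derive (a b : R) (h h' : R -> R) :
  (forall t, a <= t < b -> is_derive h t (h' t)) ->
  (forall s t, a <= s -> s <= t -> t < b -> h' t <= h' s) -> concave_on a b h.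
Proof.
  intros Hd Hm u v w Hu Huv Hvw Hw.
  assert (M : forall p q, a <= p -> p < q -> q < b ->
    exists c, p <= c <= q /\ h q - h p = h' c * (q - p)).
  { intros p q Hp Hpq Hq. destruct (MVT_gen h p q h') as [c [Hc E]].
    - intros t; rewrite Rmin_left, Rmax_right by lra; intros; apply Hd; lra.
    - intros t; rewrite Rmin_left, Rmax_right by lra; intros.
      apply derivable_continuous_pt. exists (h' t). apply is_derive_Reals, Hd; lra.
    - rewrite Rmin_left, Rmax_right in Hc by lra. now exists c. }
  destruct (M u v) as [c1 [H1 E1]]; try lra.
  destruct (M v w) as [c2 [H2 E2]]; try lra.
  rewrite E1, E2.
  assert (h' c2 <= h' c1) by (apply Hm; lra).
  assert (0 <= (v - u) * (w - v)) by nra. nra.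
Qed.

(* Up to [eta], [g] is the logarithm of the double sine function with periods [1] and [alpha]. *)
Definition approx_double_sine (alpha eta : R) (g : R -> R) : Prop :=
  (forall z, g (1 + alpha - z) = - g z) /\
  concave_on ((1 + alpha) / 2) (1 + alpha) g /\
  (forall z, 0 < z < 1 + alpha -> continuous g z) /\
  (forall z, 0 < z < 1 -> Rabs (g (z + alpha) - g z - lsin z) <= eta) /\
  (forall z, 0 < z < alpha -> Rabs (g (z + 1) - g z - lsin (z / alpha)) <= eta).

Section Approximant.

Variables (alpha : R) (n : nat).
Hypothesis Halpha : 0 < alpha.
Hypothesis Hn : (1 <= n)%nat.

Definition log_ratio (m j : nat) (z : R) : R :=
  ln (1 + alpha - z + (INR m + INR j * alpha)) - ln (z + (INR m + INR j * alpha)).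

(* This choice makes both functional equations hold in the limit [n -> oo]. *)
Definition slope : R :=
  2 / alpha * (Lam (INR n + INR n * alpha) - Lam (INR n) - Lam (INR n * alpha)).

Definition approximant (z : R) : R :=
  sumR 0 n (fun m => sumR 0 n (fun j => log_ratio m j z)) + slope * (z - (1 + alpha) / 2).

Lemma shift_pos (m j : nat) : 0 <= INR m + INR j * alpha.
Proof. assert (H1 := pos_INR m). assert (H2 := pos_INR j). nra. Qed.

Lemma approximant_antisym (z : R) : approximant (1 + alpha - z) = - approximant z.
Proof.
  unfold approximant. rewrite Ropp_plus_distr. f_equal; [|field].
  replace (- sumR 0 n _) with ((-1) * sumR 0 n (fun m => sumR 0 n (fun j => log_ratio m j z))) by ring.
  rewrite <- sumR_scal. apply sumR_ext; intros m _.
  rewrite <- sumR_scal. apply sumR_ext; intros j _.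
  unfold log_ratio. replace (1 + alpha - (1 + alpha - z)) with z by ring. ring.
Qed.

Lemma approximant_concave : concave_on ((1 + alpha) / 2) (1 + alpha) approximant.
Proof.
  assert (C : concave_on ((1 + alpha) / 2) (1 + alpha)
      (fun z => sumR 0 n (fun m => sumR 0 n (fun j => log_ratio m j z)))).
  { apply concave_on_sumR; intros m. apply concave_on_sumR; intros j.
    assert (Hs := shift_pos m j). unfold log_ratio. set (s := INR m + INR j * alpha) in *.
    apply (concave_on_of_derive _ _ _
      (fun t => - (/ (1 + alpha - t + s)) - / (t + s))).
    - intros t Ht. auto_derive; [lra|field; lra].
    - intros p q Hp Hpq Hq.
      assert (E : forall t, (1 + alpha) / 2 <= t < 1 + alpha ->
        - (/ (1 + alpha - t + s)) - / (t + s)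
        = - ((1 + alpha + 2 * s) * / ((1 + alpha - t + s) * (t + s)))).
      { intros t Ht. field; lra. }
      rewrite !E by lra. apply Ropp_le_contravar, Rmult_le_compat_l; [lra|].
      apply Rinv_le_contravar; [apply Rmult_lt_0_compat; lra|].
      nra. }
  intros u v w Hu Huv Hvw Hw. specialize (C u v w Hu Huv Hvw Hw). unfold approximant. lra.
Qed.

Lemma approximant_continuous (z : R) : 0 < z < 1 + alpha -> continuous approximant z.
Proof.
  intros Hz. unfold approximant.
  assert (S : forall (N : nat) (f : nat -> R -> R),
    (forall k, continuous (f k) z) -> continuous (fun z => sumR 0 N (fun k => f k z)) z).
  { intros N f Hf. induction N as [|N IH]; [apply continuous_const|].
    apply (continuous_plus (fun z => sumR 0 N (fun k => f k z)) (f N)); auto. }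
  apply (continuous_plus (fun z => sumR 0 n (fun m => sumR 0 n (fun j => log_ratio m j z)))
           (fun z => slope * (z - (1 + alpha) / 2))).
  - apply S; intros m. apply S; intros j. unfold log_ratio.
    assert (Hs := shift_pos m j).
    apply (@ex_derive_continuous R_AbsRing R_NormedModule). auto_derive. lra.
  - apply (@ex_derive_continuous R_AbsRing R_NormedModule). auto_derive. auto.
Qed.

Lemma approximant_step_alpha (z : R) : 1 <= INR n * alpha -> 0 < z < 1 ->
  Rabs (approximant (z + alpha) - approximant z - lsin z) <= (4 + 2 / alpha ^ 2) / INR n.
Proof.
  intros HT Hz.
  assert (B := lsin_column z alpha n Hz Halpha Hn HT).
  match type of B with Rabs ?a <= _ => replace (approximant (z + alpha) - approximant z - lsin z) with a; [exact B|] end.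
  f_equal. unfold approximant.
  replace (2 * (Lam (INR n + INR n * alpha) - Lam (INR n) - Lam (INR n * alpha)))
    with (slope * alpha) by (unfold slope; field; lra).
  match goal with |- ?a + _ = ?b + _ - (?c + _) =>
    assert (E : a = b - c); [|rewrite E; ring] end.
  rewrite <- sumR_minus. apply sumR_ext; intros m _.
  rewrite <- sumR_minus.
  assert (Hm := pos_INR m).
  set (u := fun j : nat => ln (1 - z + INR m + INR j * alpha)).
  set (v := fun j : nat => ln (z + INR m + INR j * alpha)).
  transitivity (sumR 0 n (fun j => (- u (S j) - v (S j)) - (- u j - v j))).
  - rewrite (sumR_telescope n (fun j => - u j - v j)). unfold u, v. simpl INR.
    rewrite Rmult_0_l, !Rplus_0_r. ring.
  - apply sumR_ext; intros j _. unfold log_ratio, u, v. rewrite S_INR.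
    replace (1 + alpha - (z + alpha) + (INR m + INR j * alpha)) with (1 - z + INR m + INR j * alpha) by ring.
    replace (z + alpha + (INR m + INR j * alpha)) with (z + INR m + (INR j + 1) * alpha) by ring.
    replace (1 + alpha - z + (INR m + INR j * alpha)) with (1 - z + INR m + (INR j + 1) * alpha) by ring.
    replace (z + (INR m + INR j * alpha)) with (z + INR m + INR j * alpha) by ring.
    ring.
Qed.

Lemma approximant_step_one (z : R) : 1 <= INR n / alpha -> 0 < z < alpha ->
  Rabs (approximant (z + 1) - approximant z - lsin (z / alpha)) <= (4 + 2 * alpha ^ 2) / INR n.
Proof.
  intros HT Hz.
  assert (Hn1 : 1 <= INR n) by (now apply (le_INR 1)).
  assert (Hw : 0 < z / alpha < 1).
  { split; [apply Rdiv_lt_0_compat; lra|apply Rlt_div_l; lra]. }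
  assert (B := lsin_column (z / alpha) (/ alpha) n Hw (Rinv_0_lt_compat _ Halpha) Hn HT).
  replace (2 / (/ alpha) ^ 2) with (2 * alpha ^ 2) in B by (field; lra).
  match type of B with Rabs ?a <= _ => replace (approximant (z + 1) - approximant z - lsin (z / alpha)) with a; [exact B|] end.
  f_equal. unfold approximant.
  assert (HLam : forall w, 0 < w -> Lam (w / alpha) = (Lam w - w * ln alpha) / alpha).
  { intros w Hw'. unfold Lam. rewrite ln_div by lra. field; lra. }
  replace (2 * (Lam (INR n + INR n * / alpha) - Lam (INR n) - Lam (INR n * / alpha))) with slope.
  2:{ replace (INR n + INR n * / alpha) with ((INR n + INR n * alpha) / alpha) by (field; lra).
      rewrite (HLam (INR n + INR n * alpha)) by nra.
      change (INR n * / alpha) with (INR n / alpha). rewrite (HLam (INR n)) by lra.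
      assert (E := HLam (INR n * alpha) ltac:(nra)).
      replace (INR n * alpha / alpha) with (INR n) in E by (field; lra).
      assert (E' : Lam (INR n * alpha) = alpha * Lam (INR n) + INR n * alpha * ln alpha)
        by (rewrite E; field; lra).
      unfold slope. rewrite E'. field; lra. }
  match goal with |- ?a + _ = ?b + _ - (?c + _) =>
    assert (E : a = b - c); [|rewrite E; ring] end.
  rewrite !(sumR_swap n n (fun m j => log_ratio m j _)).
  rewrite <- sumR_minus. apply sumR_ext; intros j _.
  rewrite <- sumR_minus.
  assert (Hj := pos_INR j).
  set (u := fun m : nat => ln (alpha - z + INR m + INR j * alpha)).
  set (v := fun m : nat => ln (z + INR m + INR j * alpha)).
  transitivity (sumR 0 n (fun m => (- u (S m) - v (S m)) - (- u m - v m))).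
  - rewrite (sumR_telescope n (fun m => - u m - v m)). unfold u, v. simpl (INR 0).
    assert (0 < INR n / alpha) by (apply Rdiv_lt_0_compat; lra).
    assert (L : forall w, 0 < w -> ln (alpha * w) = ln alpha + ln w).
    { intros w Hw'. now apply ln_mult. }
    replace (alpha - z + INR n + INR j * alpha)
      with (alpha * (1 - z / alpha + INR j + INR n * / alpha)) by (field; lra).
    replace (z + INR n + INR j * alpha)
      with (alpha * (z / alpha + INR j + INR n * / alpha)) by (field; lra).
    replace (alpha - z + 0 + INR j * alpha) with (alpha * (1 - z / alpha + INR j)) by (field; lra).
    replace (z + 0 + INR j * alpha) with (alpha * (z / alpha + INR j)) by (field; lra).
    rewrite !L by (unfold Rdiv in *; lra). ring.
  - apply sumR_ext; intros m _. unfold log_ratio, u, v. rewrite S_INR.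
    replace (1 + alpha - (z + 1) + (INR m + INR j * alpha)) with (alpha - z + INR m + INR j * alpha) by ring.
    replace (z + 1 + (INR m + INR j * alpha)) with (z + (INR m + 1) + INR j * alpha) by ring.
    replace (1 + alpha - z + (INR m + INR j * alpha)) with (alpha - z + (INR m + 1) + INR j * alpha) by ring.
    replace (z + (INR m + INR j * alpha)) with (z + INR m + INR j * alpha) by ring.
    ring.
Qed.

End Approximant.

Lemma approx_double_sine_exists (alpha eta : R) :
  0 < alpha -> 0 < eta -> exists g, approx_double_sine alpha eta g.
Proof.
  intros Ha He.
  assert (H1 : 0 < / alpha) by (now apply Rinv_0_lt_compat).
  assert (H2 : 0 < 2 / alpha ^ 2) by (apply Rdiv_lt_0_compat; [lra|apply pow_lt; lra]).
  assert (H3 : 0 < 2 * alpha ^ 2) by (assert (0 < alpha ^ 2) by (apply pow_lt; lra); lra).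
  set (X := (4 + 2 / alpha ^ 2) / eta + (4 + 2 * alpha ^ 2) / eta).
  assert (H4 : 0 < (4 + 2 / alpha ^ 2) / eta) by (apply Rdiv_lt_0_compat; lra).
  assert (H5 : 0 < (4 + 2 * alpha ^ 2) / eta) by (apply Rdiv_lt_0_compat; lra).
  destruct (INR_unbounded (1 + / alpha + alpha + X)) as [n Hn].
  assert (Hn1 : (1 <= n)%nat) by (apply INR_le; simpl; unfold X in *; lra).
  assert (HX : forall c, c / eta < INR n -> c / INR n <= eta).
  { intros c Hc. apply Rle_div_l; [unfold X in *; lra|].
    apply Rlt_div_l in Hc; lra. }
  exists (approximant alpha n). unfold approx_double_sine. repeat split.
  - apply (approximant_antisym alpha n).
  - apply approximant_concave; auto.
  - apply approximant_continuous; auto.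
  - intros z Hz. eapply Rle_trans; [apply approximant_step_alpha; auto|].
    + assert (/ alpha * alpha = 1) by (field; lra). unfold X in *. nra.
    + apply HX. unfold X in *; lra.
  - intros z Hz. eapply Rle_trans; [apply approximant_step_one; auto|].
    + apply Rle_div_r; [lra|]. unfold X in *; lra.
    + apply HX. unfold X in *; lra.
Qed.

(** * Reciprocity *)

Lemma Rabs_sin_PI_shift (w : R) (k : Z) : Rabs (sin (PI * (w + IZR k))) = Rabs (sin (PI * w)).
Proof.
  assert (Hs : sin (IZR k * PI) = 0) by (apply sin_eq_0_1; now exists k).
  assert (Hc := sin2_cos2 (IZR k * PI)). rewrite Hs in Hc. unfold Rsqr in Hc.
  replace (PI * (w + IZR k)) with (PI * w + IZR k * PI) by ring.
  rewrite sin_plus, Hs, Rmult_0_r, Rplus_0_r, Rabs_mult.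
  assert (Ha := Rabs_pos (cos (IZR k * PI))).
  assert (Hm : Rabs (cos (IZR k * PI)) * Rabs (cos (IZR k * PI)) = 1).
  { rewrite <- Rabs_mult. replace (_ * _) with 1 by lra. apply Rabs_R1. }
  replace (Rabs (cos (IZR k * PI))) with 1 by nra. ring.
Qed.

Lemma irrational_mult (alpha : R) (n : nat) (k : Z) :
  irrational alpha -> (1 <= n)%nat -> INR n * alpha <> IZR k.
Proof.
  intros Hi Hn E. apply (Hi k (Z.of_nat n)); [lia|].
  rewrite <- INR_IZR_INZ. assert (1 <= INR n) by (now apply (le_INR 1)).
  rewrite <- E. field; lra.
Qed.

Lemma P_factor_pos (alpha : R) (n : nat) :
  irrational alpha -> 0 < Rabs (2 * sin (PI * INR (S n) * alpha)).
Proof.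
  intros Hi. apply Rabs_pos_lt. intros E.
  destruct (sin_eq_0_0 (PI * INR (S n) * alpha) ltac:(lra)) as [k Hk].
  assert (HP := PI_RGT_0).
  apply (irrational_mult alpha (S n) k Hi ltac:(lia)). nra.
Qed.

Lemma P_pos (alpha : R) (n : nat) : irrational alpha -> 0 < P alpha n.
Proof.
  intros Hi. induction n as [|n IH]; [simpl; lra|].
  change (0 < P alpha n * Rabs (2 * sin (PI * INR (S n) * alpha))).
  apply Rmult_lt_0_compat; [exact IH|now apply P_factor_pos].
Qed.

Lemma P_shift (alpha : R) (k : Z) (n : nat) : P (alpha + IZR k) n = P alpha n.
Proof.
  induction n as [|n IH]; [reflexivity|].
  change (P (alpha + IZR k) n * Rabs (2 * sin (PI * INR (S n) * (alpha + IZR k)))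
          = P alpha n * Rabs (2 * sin (PI * INR (S n) * alpha))).
  rewrite IH, !Rabs_mult. do 2 f_equal.
  rewrite !Rmult_assoc, Rmult_plus_distr_l.
  rewrite (INR_IZR_INZ (S n)) at 2. rewrite <- mult_IZR. apply Rabs_sin_PI_shift.
Qed.

Lemma ln_P_S (alpha w : R) (n : nat) (k : Z) : irrational alpha -> 0 < w < 1 ->
  INR (S n) * alpha = w + IZR k -> ln (P alpha (S n)) = ln (P alpha n) + lsin w.
Proof.
  intros Hi Hw E.
  change (ln (P alpha n * Rabs (2 * sin (PI * INR (S n) * alpha))) = ln (P alpha n) + lsin w).
  rewrite ln_mult by (try apply P_factor_pos; try apply P_pos; auto).
  f_equal. unfold lsin. f_equal.
  rewrite Rabs_mult, Rmult_assoc, E, Rabs_sin_PI_shift.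
  assert (H := sin_PI_pos w Hw). rewrite !Rabs_pos_eq by lra. reflexivity.
Qed.

Lemma irrational_inv (alpha : R) : irrational alpha -> irrational (/ alpha).
Proof.
  intros Hi p q Hq E.
  assert (Hq' : IZR q <> 0) by (intros H; apply Hq; now apply eq_IZR).
  destruct (Req_dec alpha 0) as [H0|H0].
  - apply (Hi 0%Z 1%Z); [lia|]. rewrite H0; field.
  - assert (Hp : IZR p <> 0).
    { intros H. rewrite H in E. apply (Rinv_neq_0_compat alpha H0). rewrite E; field; auto. }
    apply (Hi q p).
    + intros ->; now apply Hp.
    + rewrite <- (Rinv_inv alpha), E. field; auto.
Qed.

(* Walk from [(0, 0)] to [(n, m)] by unit steps along which [(n + 1) alpha - m] stays in [(0, 1 + alpha)]. *)
Lemma P_reciprocity (alpha eta : R) (g : R -> R) (n m : nat) :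
  irrational alpha -> 0 < alpha -> approx_double_sine alpha eta g ->
  0 < INR (S n) * alpha - INR m < 1 + alpha ->
  Rabs (ln (P alpha n) - ln (P (/ alpha) m) - (g (INR (S n) * alpha - INR m) - g alpha))
    <= INR (n + m) * eta.
Proof.
  intros Hi Ha [_ [_ [_ [F1 F2]]]].
  remember (n + m)%nat as s eqn:Hs. revert n m Hs.
  induction s as [|s IH]; intros n m Hs Hz.
  - assert (n = O) by lia. assert (m = O) by lia. subst. simpl.
    rewrite Rmult_1_l, Rminus_0_r, !Rminus_diag, Rabs_R0. lra.
  - set (z := INR (S n) * alpha - INR m) in *.
    rewrite S_INR.
    assert (Ez : z = INR n * alpha + alpha - INR m) by (unfold z; rewrite S_INR; ring).
    destruct (Rtotal_order z alpha) as [Hlt|[Heq|Hgt]].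
    + destruct m as [|m].
      { exfalso. assert (H := pos_INR n). simpl in Ez. nra. }
      assert (Hw : 0 < z / alpha < 1).
      { split; [apply Rdiv_lt_0_compat; lra|apply Rlt_div_l; lra]. }
      rewrite (ln_P_S (/ alpha) (1 - z / alpha) m (Z.of_nat n)).
      2: now apply irrational_inv. 2: lra.
      2: { rewrite <- INR_IZR_INZ, Ez. field; lra. }
      rewrite lsin_sym.
      assert (B := F2 z ltac:(lra)).
      specialize (IH n m ltac:(lia)).
      rewrite S_INR in Ez.
      replace (INR (S n) * alpha - INR m) with (z + 1) in IH by (rewrite Ez, S_INR; ring).
      specialize (IH ltac:(lra)).
      apply Rabs_le_between in B, IH. apply Rabs_le. lra.
    + exfalso. destruct n as [|n].
      * destruct m as [|m]; [lia|]. assert (H := pos_INR m). rewrite S_INR in Ez. simpl in Ez. lra.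
      * apply (irrational_mult alpha (S n) (Z.of_nat m) Hi ltac:(lia)).
        rewrite <- INR_IZR_INZ. lra.
    + destruct n as [|n].
      { exfalso. assert (H := pos_INR m). simpl in Ez. lra. }
      rewrite (ln_P_S alpha (z - alpha) n (Z.of_nat m)); auto; [|lra|rewrite <- INR_IZR_INZ; lra].
      assert (B := F1 (z - alpha) ltac:(lra)).
      replace (z - alpha + alpha) with z in B by ring.
      specialize (IH n m ltac:(lia)).
      replace (INR (S n) * alpha - INR m) with (z - alpha) in IH by lra.
      specialize (IH ltac:(lra)).
      apply Rabs_le_between in B, IH. apply Rabs_le. lra.
Qed.

Lemma double_sine_at_alpha (alpha eta : R) (g : R -> R) :
  0 < alpha -> approx_double_sine alpha eta g -> Rabs (g alpha + / 2 * ln (/ alpha)) <= eta.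
Proof.
  intros Ha [As [_ [Cg [F1 F2]]]].
  assert (E1 : g 1 = - g alpha).
  { rewrite <- As. f_equal; ring. }
  apply le_epsilon. intros eps He.
  assert (C1 := proj2 (continuity_pt_filterlim g 1) (Cg 1 ltac:(lra)) (eps / 2) ltac:(lra)).
  assert (C2 := proj2 (continuity_pt_filterlim g alpha) (Cg alpha ltac:(lra)) (eps / 2) ltac:(lra)).
  destruct C1 as [d1 [Hd1 C1]]. destruct C2 as [d2 [Hd2 C2]].
  unfold dist in C1, C2; simpl in C1, C2. unfold Rdist in C1, C2.
  set (z := Rmin (Rmin (d1 / 2) (d2 / 2)) (Rmin (Rmin (1 / 8) (alpha / 8)) (Rmin (eps / 40) (eps * alpha / 40)))).
  assert (Hz : 0 < z).
  { unfold z. repeat apply Rmin_glb_lt; nra. }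
  assert (Z1 : z <= Rmin (d1 / 2) (d2 / 2)) by apply Rmin_l.
  assert (Z2 : z <= Rmin (Rmin (1 / 8) (alpha / 8)) (Rmin (eps / 40) (eps * alpha / 40))) by apply Rmin_r.
  assert (Z3 := Rmin_l (d1 / 2) (d2 / 2)). assert (Z4 := Rmin_r (d1 / 2) (d2 / 2)).
  assert (Z5 := Rmin_l (Rmin (1 / 8) (alpha / 8)) (Rmin (eps / 40) (eps * alpha / 40))).
  assert (Z6 := Rmin_r (Rmin (1 / 8) (alpha / 8)) (Rmin (eps / 40) (eps * alpha / 40))).
  assert (Z7 := Rmin_l (1 / 8) (alpha / 8)). assert (Z8 := Rmin_r (1 / 8) (alpha / 8)).
  assert (Z9 := Rmin_l (eps / 40) (eps * alpha / 40)). assert (Z10 := Rmin_r (eps / 40) (eps * alpha / 40)).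
  assert (K1 : Rabs (g (z + 1) - g 1) < eps / 2).
  { apply C1. split; [split; [exact I|lra]|].
    replace (z + 1 - 1) with z by ring. rewrite Rabs_pos_eq; lra. }
  assert (K2 : Rabs (g (z + alpha) - g alpha) < eps / 2).
  { apply C2. split; [split; [exact I|lra]|].
    replace (z + alpha - alpha) with z by ring. rewrite Rabs_pos_eq; lra. }
  assert (Hza : 0 < z / alpha <= 1 / 8).
  { split; [apply Rdiv_lt_0_compat; lra|apply Rle_div_l; lra]. }
  assert (Hze : z / alpha <= eps / 40) by (apply Rle_div_l; lra).
  assert (G1 := F1 z ltac:(lra)). assert (G2 := F2 z ltac:(lra)).
  assert (HP := PI_gt_3). assert (HP4 := PI_4).
  assert (L : forall w, 0 < w <= 1 / 8 -> w <= eps / 40 -> Rabs (lsin w - (ln 2 + ln PI + ln w)) <= eps / 2).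
  { intros w Hw Hw2. unfold lsin.
    assert (B := ln_sin_near (PI * w) ltac:(nra)).
    assert (S := sin_PI_pos w ltac:(lra)).
    rewrite ln_mult by lra. rewrite (ln_mult PI) in B by lra.
    assert ((PI * w) ^ 2 <= eps / 2).
    { assert (PI * w <= / 2) by nra. assert (PI * w <= eps) by nra. assert (0 < PI * w) by nra. nra. }
    apply Rabs_le_between in B. apply Rabs_le. lra. }
  assert (L1 := L z ltac:(lra) ltac:(lra)). assert (L2 := L (z / alpha) Hza Hze).
  assert (Eln : ln (z / alpha) = ln z + ln (/ alpha)).
  { unfold Rdiv. apply ln_mult; [lra|]. now apply Rinv_0_lt_compat. }
  rewrite E1 in K1. rewrite Eln in L2.
  apply Rabs_def2 in K1, K2. apply Rabs_le_between in G1, G2, L1, L2.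
  apply Rabs_le. lra.
Qed.

(** * Size of the double sine function *)

Lemma is_derive_lsin (x : R) : 0 < x < 1 ->
  is_derive lsin x (PI * cos (PI * x) / sin (PI * x)).
Proof.
  intros Hx. assert (H := sin_PI_pos x Hx). unfold lsin. auto_derive; [lra|field; lra].
Qed.

Lemma continuous_lsin (x : R) : 0 < x < 1 -> continuous lsin x.
Proof.
  intros Hx. apply (@ex_derive_continuous R_AbsRing R_NormedModule).
  eexists. now apply is_derive_lsin.
Qed.

Lemma ex_RInt_lsin (a b : R) : 0 < a < 1 -> 0 < b < 1 -> ex_RInt lsin a b.
Proof.
  intros Ha Hb. apply (@ex_RInt_continuous R_CompleteNormedModule). intros z Hz.
  apply continuous_lsin. split.
  - apply Rlt_le_trans with (Rmin a b); [apply Rmin_glb_lt; lra|lra].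
  - apply Rle_lt_trans with (Rmax a b); [lra|apply Rmax_lub_lt; lra].
Qed.

Definition lsin_int (t : R) : R := RInt lsin (/ 2) t.

Lemma is_derive_lsin_int (t : R) : 0 < t < 1 -> is_derive lsin_int t (lsin t).
Proof.
  intros Ht. apply (is_derive_RInt lsin lsin_int (/ 2) t); [|now apply continuous_lsin].
  assert (Hd : 0 < Rmin t (1 - t)) by (apply Rmin_glb_lt; lra).
  exists (mkposreal _ Hd). intros b Hb.
  apply (@RInt_correct R_CompleteNormedModule), ex_RInt_lsin; [lra|].
  unfold ball in Hb; simpl in Hb; unfold AbsRing_ball, abs, minus, plus, opp in Hb; simpl in Hb.
  apply Rabs_def2 in Hb.
  assert (H1 := Rmin_l t (1 - t)). assert (H2 := Rmin_r t (1 - t)). lra.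
Qed.

Lemma lsin_int_mvt (a b : R) : 0 < a -> a <= b -> b < 1 ->
  exists c, a <= c <= b /\ lsin_int b - lsin_int a = lsin c * (b - a).
Proof.
  intros Ha Hab Hb.
  destruct (MVT_gen lsin_int a b lsin) as [c [Hc E]].
  - intros t; rewrite Rmin_left, Rmax_right by lra; intros; apply is_derive_lsin_int; lra.
  - intros t; rewrite Rmin_left, Rmax_right by lra; intros.
    apply derivable_continuous_pt. exists (lsin t). apply is_derive_Reals, is_derive_lsin_int; lra.
  - rewrite Rmin_left, Rmax_right in Hc by lra. now exists c.
Qed.

Lemma lsin_lipschitz (u v : R) : / 2 <= u <= 11 / 12 -> / 2 <= v <= 11 / 12 ->
  Rabs (lsin u - lsin v) <= 24 * Rabs (u - v).
Proof.
  intros Hu Hv.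
  assert (Hrange : forall t, Rmin v u <= t <= Rmax v u -> / 2 <= t <= 11 / 12).
  { intros t Ht. split.
    - apply Rle_trans with (Rmin v u); [apply Rmin_glb; lra|lra].
    - apply Rle_trans with (Rmax v u); [lra|apply Rmax_lub; lra]. }
  destruct (MVT_gen lsin v u (fun x => PI * cos (PI * x) / sin (PI * x))) as [c [Hc E]].
  - intros t Ht. apply is_derive_lsin. assert (B := Hrange t ltac:(lra)). lra.
  - intros t Ht. apply derivable_continuous_pt. eexists.
    apply is_derive_Reals, is_derive_lsin. assert (B := Hrange t Ht). lra.
  - rewrite E, Rabs_mult. apply Rmult_le_compat_r; [apply Rabs_pos|].
    apply Hrange in Hc. assert (HP := PI_gt_3).
    assert (S : PI / 24 <= sin (PI * c)).
    { rewrite <- sin_PI_x. replace (PI - PI * c) with (PI * (1 - c)) by ring.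
      assert (B := sin_ge_half (PI * (1 - c)) ltac:(nra)). nra. }
    unfold Rdiv at 1. rewrite !Rabs_mult, Rabs_inv.
    rewrite (Rabs_pos_eq PI), (Rabs_pos_eq (sin _)) by lra.
    assert (C : Rabs (cos (PI * c)) <= 1) by (apply Rabs_le, COS_bound).
    apply Rle_div_l; [lra|]. assert (Ca := Rabs_pos (cos (PI * c))). nra.
Qed.

Lemma lsin_int_midpoint (t h : R) : / 2 + h <= t <= 5 / 6 -> 0 <= h <= 1 / 12 ->
  Rabs (lsin_int (t + h) - lsin_int (t - h) - 2 * h * lsin t) <= 94 * h ^ 3.
Proof.
  intros Ht Hh.
  assert (Hsin : / 2 <= sin (PI * t)).
  { rewrite <- sin_PI_x, <- Rdiv_1_l, <- sin_PI6.
    assert (HP := PI_RGT_0). apply sin_incr_1; nra. }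
  set (psi := fun s => lsin_int (t + s) - lsin_int (t - s) - 2 * s * lsin t).
  assert (Hd : forall s, 0 <= s <= h -> is_derive psi s (lsin (t + s) + lsin (t - s) - 2 * lsin t)).
  { intros s Hs. unfold psi.
    assert (D1 := is_derive_lsin_int (t + s) ltac:(lra)).
    assert (D2 := is_derive_lsin_int (t - s) ltac:(lra)).
    auto_derive.
    - repeat split; eexists; eassumption.
    - assert (E1 : Derive (fun x => lsin_int x) (t + s) = lsin (t + s)) by exact (is_derive_unique _ _ _ D1).
      assert (E2 : Derive (fun x => lsin_int x) (t + - s) = lsin (t - s)) by exact (is_derive_unique _ _ _ D2).
      rewrite E1, E2. ring. }
  destruct (MVT_gen psi 0 h (fun s => lsin (t + s) + lsin (t - s) - 2 * lsin t)) as [c [Hc E]].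
  - intros s; rewrite Rmin_left, Rmax_right by lra; intros; apply Hd; lra.
  - intros s; rewrite Rmin_left, Rmax_right by lra; intros.
    apply derivable_continuous_pt. eexists. apply is_derive_Reals, Hd; lra.
  - rewrite Rmin_left, Rmax_right in Hc by lra.
    assert (E0 : psi 0 = 0) by (unfold psi; rewrite Rplus_0_r, Rminus_0_r; ring).
    change (lsin_int (t + h) - lsin_int (t - h) - 2 * h * lsin t) with (psi h).
    rewrite E0, !Rminus_0_r in E. rewrite E, Rabs_mult, (Rabs_pos_eq h) by lra.
    assert (U := lsin_pair_le t c ltac:(lra) ltac:(lra)).
    assert (Hq : 47 * c ^ 2 <= / 2) by nra.
    assert (L : 2 * lsin t - 2 * (47 * c ^ 2) <= lsin (t + c) + lsin (t - c)).
    { apply lsin_pair_ge; [lra|lra| |nra].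
      eapply Rle_trans; [apply sin_sq_le|].
      assert (HP := PI_lt_3_4). assert (HP0 := PI_RGT_0).
      assert (PI ^ 2 <= 47 * / 4) by nra.
      assert (/ 4 <= sin (PI * t) ^ 2) by nra.
      rewrite Rpow_mult_distr. assert (0 <= c ^ 2) by nra. nra. }
    assert (c ^ 2 <= h ^ 2) by nra.
    replace (94 * h ^ 3) with (94 * h ^ 2 * h) by ring.
    apply Rmult_le_compat_r; [lra|]. apply Rabs_le. lra.
Qed.

Lemma ln_2_bounds : / 2 <= ln 2 < 1.
Proof.
  split; [assert (H := ln1p_ge_quad 1 ltac:(lra)); replace (1 + 1) with 2 in H by ring; lra|].
  rewrite <- ln_exp. apply ln_increasing; [lra|].
  assert (H := exp_ineq1 1 ltac:(lra)). lra.
Qed.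

Section Level.

Variables (alpha eta : R) (g : R -> R).
Hypothesis Halpha : 0 < alpha < 1.
Hypothesis Heta : 0 < eta <= 1.
Hypothesis Hg : approx_double_sine alpha eta g.

Lemma double_sine_center : g ((1 + alpha) / 2) = 0.
Proof.
  destruct Hg as [As _]. specialize (As ((1 + alpha) / 2)).
  replace (1 + alpha - (1 + alpha) / 2) with ((1 + alpha) / 2) in As by field. lra.
Qed.

Lemma double_sine_center_half_alpha : Rabs (g (/ 2 + alpha) - / 2 * ln 2) <= eta / 2.
Proof.
  destruct Hg as [As [_ [_ [F1 _]]]].
  assert (B := F1 (/ 2) ltac:(lra)). rewrite lsin_half in B.
  assert (A1 := As (/ 2 + alpha)).
  replace (1 + alpha - (/ 2 + alpha)) with (/ 2) in A1 by field.
  rewrite A1 in B. apply Rabs_le_between in B. apply Rabs_le. lra.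
Qed.

Lemma double_sine_center_half : Rabs (g (1 + alpha / 2) - / 2 * ln 2) <= eta / 2.
Proof.
  destruct Hg as [As [_ [_ [_ F2]]]].
  assert (B := F2 (alpha / 2) ltac:(lra)).
  replace (alpha / 2 / alpha) with (/ 2) in B by (field; lra). rewrite lsin_half in B.
  assert (A1 := As (alpha / 2 + 1)).
  replace (1 + alpha - (alpha / 2 + 1)) with (alpha / 2) in A1 by field.
  rewrite A1 in B. rewrite (Rplus_comm 1). apply Rabs_le_between in B. apply Rabs_le. lra.
Qed.

Lemma double_sine_le (z : R) : 1 / 12 <= alpha -> (1 + alpha) / 2 <= z < 1 + alpha ->
  g z <= 13 + eta / (1 - alpha).
Proof.
  intros H12 Hz.
  assert (L := ln_2_bounds).
  assert (G0 := double_sine_center).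
  assert (G1 := double_sine_center_half_alpha). assert (G2 := double_sine_center_half).
  destruct Hg as [_ [Cc _]].
  assert (He : 0 < eta / (1 - alpha)) by (apply Rdiv_lt_0_compat; lra).
  apply Rabs_le_between in G1, G2.
  destruct (Rtotal_order z (/ 2 + alpha)) as [Hlt|[->|Hgt]]; [| lra |].
  - assert (C := Cc z (/ 2 + alpha) (1 + alpha / 2) ltac:(lra) ltac:(lra) ltac:(lra) ltac:(lra)).
    assert (E : eta / (1 - alpha) * (1 - alpha) = eta) by (field; lra).
    set (q := eta / (1 - alpha)) in *.
    assert (g z <= g (/ 2 + alpha) + q); [|lra].
    assert (- eta * (/ 2 + alpha - z) <= (g (/ 2 + alpha) - g z) * (1 + alpha / 2 - (/ 2 + alpha))) by nra.
    assert (- eta * / 2 <= (g (/ 2 + alpha) - g z) * ((1 - alpha) / 2)) by nra.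
    nra.
  - assert (C := Cc ((1 + alpha) / 2) (/ 2 + alpha) z ltac:(lra) ltac:(lra) Hgt ltac:(lra)).
    rewrite G0 in C.
    assert (g z * (alpha / 2) <= g (/ 2 + alpha) * (z - (1 + alpha) / 2)) by nra.
    assert (g (/ 2 + alpha) * (z - (1 + alpha) / 2) <= z - (1 + alpha) / 2) by nra.
    nra.
Qed.

Lemma double_sine_bounded (z : R) : 1 / 12 <= alpha -> alpha / 6 <= z <= 1 + 5 / 6 * alpha ->
  Rabs (g z) <= 13 + eta / (1 - alpha) + eta.
Proof.
  intros H12.
  assert (He : 0 < eta / (1 - alpha)) by (apply Rdiv_lt_0_compat; lra).
  assert (H : forall y, (1 + alpha) / 2 <= y <= 1 + 5 / 6 * alpha ->
    Rabs (g y) <= 13 + eta / (1 - alpha) + eta).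
  { intros y Hy. assert (U := double_sine_le y H12 ltac:(lra)).
    apply Rabs_le. split; [|lra].
    assert (G0 := double_sine_center).
    assert (W : - (13 + eta / (1 - alpha) + eta) <= g (1 + 5 / 6 * alpha)).
    { assert (U' := double_sine_le (1 + alpha / 6) H12 ltac:(lra)).
      destruct Hg as [As [_ [_ [_ F2]]]].
      assert (B := F2 (5 / 6 * alpha) ltac:(lra)).
      replace (5 / 6 * alpha / alpha) with (5 / 6) in B by (field; lra).
      rewrite lsin_5_6, (Rplus_comm _ 1) in B.
      assert (A1 := As (1 + alpha / 6)).
      replace (1 + alpha - (1 + alpha / 6)) with (5 / 6 * alpha) in A1 by field.
      apply Rabs_le_between in B. lra. }
    set (b := 13 + eta / (1 - alpha) + eta) in *.
    destruct (Req_dec y ((1 + alpha) / 2)) as [->|N1]; [unfold b; lra|].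
    destruct (Req_dec y (1 + 5 / 6 * alpha)) as [->|N2]; [exact W|].
    destruct Hg as [_ [Cc _]].
    assert (C := Cc ((1 + alpha) / 2) y (1 + 5 / 6 * alpha) ltac:(lra) ltac:(lra) ltac:(lra) ltac:(lra)).
    rewrite G0 in C.
    assert (0 < b) by (unfold b; lra).
    assert (g (1 + 5 / 6 * alpha) * (y - (1 + alpha) / 2)
            <= g y * (1 + 5 / 6 * alpha - (1 + alpha) / 2)) by nra.
    assert (- b * (y - (1 + alpha) / 2) <= g (1 + 5 / 6 * alpha) * (y - (1 + alpha) / 2)) by nra.
    destruct (Rle_dec (- b) (g y)); [lra|]. nra. }
  intros Hz. destruct (Rle_dec ((1 + alpha) / 2) z); [apply H; lra|].
  destruct Hg as [As _]. rewrite <- Rabs_Ropp, <- As. apply H; lra.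
Qed.

Lemma double_sine_near_center (s : R) : alpha <= 1 / 12 -> 0 <= s < alpha ->
  Rabs (g ((1 + alpha) / 2 + s) - s / alpha * ln 2) <= 12 * alpha + 2 * eta.
Proof.
  intros H12 Hs.
  assert (L := ln_2_bounds).
  assert (G0 := double_sine_center). assert (G1 := double_sine_center_half_alpha).
  destruct Hg as [_ [Cc [_ [F1 _]]]].
  assert (G2 := F1 (/ 2 + alpha) ltac:(lra)).
  assert (Lp := lsin_lipschitz (/ 2 + alpha) (/ 2) ltac:(lra) ltac:(lra)).
  rewrite lsin_half in Lp. replace (/ 2 + alpha - / 2) with alpha in Lp by ring.
  rewrite (Rabs_pos_eq alpha) in Lp by lra.
  apply Rabs_le_between in G1, G2, Lp.
  set (p1 := / 2 + alpha) in *. set (c := (1 + alpha) / 2) in *.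
  assert (Hp1 : p1 = c + alpha / 2) by (unfold p1, c; field).
  assert (Hc : c + 3 / 2 * alpha < 1 + alpha) by (unfold c; lra).
  set (sg := s / alpha).
  assert (Es : s = sg * alpha) by (unfold sg; field; lra).
  assert (Hsg : 0 <= sg < 1) by (split; [apply Rdiv_le_0_compat|apply Rlt_div_l]; lra).
  set (w := ln 2) in *.
  destruct (Req_dec s 0) as [S0|S0].
  { unfold sg. rewrite S0, Rplus_0_r, G0. unfold Rdiv; rewrite !Rmult_0_l, Rminus_0_r, Rabs_R0. lra. }
  destruct (Rtotal_order s (alpha / 2)) as [Hlt|[Heq|Hgt]].
  - assert (C1 := Cc c (c + s) p1 ltac:(lra) ltac:(lra) ltac:(lra) ltac:(lra)).
    assert (C2 := Cc (c + s) p1 (p1 + alpha) ltac:(lra) ltac:(lra) ltac:(lra) ltac:(lra)).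
    rewrite G0 in C1. set (y := g (c + s)) in *.
    assert (C1' : g p1 * (2 * sg) <= y).
    { apply Rmult_le_reg_r with (alpha / 2); [lra|].
      replace (g p1 * (2 * sg) * (alpha / 2)) with (g p1 * s) by (rewrite Es; field). nra. }
    assert (C2' : y <= g p1 - (g (p1 + alpha) - g p1) * (/ 2 - sg)).
    { apply Rmult_le_reg_r with alpha; [lra|].
      replace ((g p1 - (g (p1 + alpha) - g p1) * (/ 2 - sg)) * alpha)
        with (g p1 * alpha - (g (p1 + alpha) - g p1) * (alpha / 2 - s)) by (rewrite Es; field). nra. }
    assert (Hsg2 : sg <= / 2) by nra.
    assert ((w - 24 * alpha - eta) * (/ 2 - sg) <= (g (p1 + alpha) - g p1) * (/ 2 - sg))
      by (apply Rmult_le_compat_r; lra).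
    assert ((/ 2 * w - eta / 2) * (2 * sg) <= g p1 * (2 * sg)) by (apply Rmult_le_compat_r; lra).
    apply Rabs_le. nra.
  - assert (sg = / 2) by (unfold sg; rewrite Heq; field; lra).
    rewrite Heq, <- Hp1. rewrite H. apply Rabs_le. lra.
  - assert (C1 := Cc c p1 (c + s) ltac:(lra) ltac:(lra) ltac:(lra) ltac:(lra)).
    assert (C2 := Cc p1 (c + s) (p1 + alpha) ltac:(lra) ltac:(lra) ltac:(lra) ltac:(lra)).
    rewrite G0 in C1. set (y := g (c + s)) in *.
    assert (C1' : y <= g p1 * (2 * sg)).
    { apply Rmult_le_reg_r with (alpha / 2); [lra|].
      replace (g p1 * (2 * sg) * (alpha / 2)) with (g p1 * s) by (rewrite Es; field). nra. }
    assert (C2' : g p1 + (g (p1 + alpha) - g p1) * (sg - / 2) <= y).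
    { apply Rmult_le_reg_r with alpha; [lra|].
      replace ((g p1 + (g (p1 + alpha) - g p1) * (sg - / 2)) * alpha)
        with (g p1 * alpha + (g (p1 + alpha) - g p1) * (s - alpha / 2)) by (rewrite Es; field). nra. }
    assert (Hsg2 : / 2 <= sg) by nra.
    assert ((w - 24 * alpha - eta) * (sg - / 2) <= (g (p1 + alpha) - g p1) * (sg - / 2))
      by (apply Rmult_le_compat_r; lra).
    assert (g p1 * (2 * sg) <= (/ 2 * w + eta / 2) * (2 * sg)) by (apply Rmult_le_compat_r; lra).
    apply Rabs_le. nra.
Qed.

Lemma double_sine_vs_integral (j : nat) (t : R) : alpha <= 1 / 12 ->
  (1 + alpha) / 2 + INR j * alpha <= t < (1 + alpha) / 2 + (INR j + 1) * alpha ->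
  t <= 5 / 6 + alpha ->
  Rabs (g t - lsin_int (t - alpha / 2) / alpha)
    <= 36 * alpha + 2 * eta + INR j * (12 * alpha ^ 2 + eta).
Proof.
  intros H12. revert t. induction j as [|j IH]; intros t Ht Ht2.
  - simpl INR in *.
    assert (B := double_sine_near_center (t - (1 + alpha) / 2) H12 ltac:(lra)).
    replace ((1 + alpha) / 2 + (t - (1 + alpha) / 2)) with t in B by ring.
    destruct (lsin_int_mvt (/ 2) (t - alpha / 2) ltac:(lra) ltac:(lra) ltac:(lra)) as [c [Hc E]].
    assert (E0 : lsin_int (/ 2) = 0) by apply (@RInt_point R_CompleteNormedModule).
    rewrite E0, Rminus_0_r in E.
    assert (Lp := lsin_lipschitz c (/ 2) ltac:(lra) ltac:(lra)). rewrite lsin_half in Lp.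
    rewrite (Rabs_pos_eq (c - / 2)) in Lp by lra.
    rewrite E. set (s := t - (1 + alpha) / 2) in *.
    replace (lsin c * (t - alpha / 2 - / 2) / alpha) with (lsin c * (s / alpha)) by (unfold s; field; lra).
    assert (Hsg : 0 <= s / alpha < 1).
    { split; [apply Rdiv_le_0_compat|apply Rlt_div_l]; unfold s; lra. }
    assert (Hcs : c - / 2 <= alpha) by lra.
    apply Rabs_le_between in B, Lp. apply Rabs_le. nra.
  - rewrite S_INR in *.
    assert (Hj := pos_INR j).
    assert (0 <= INR j * alpha) by nra.
    specialize (IH (t - alpha) ltac:(lra) ltac:(lra)).
    assert (M := lsin_int_midpoint (t - alpha) (alpha / 2) ltac:(lra) ltac:(lra)).
    destruct Hg as [_ [_ [_ [F1 _]]]].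
    assert (F := F1 (t - alpha) ltac:(lra)).
    replace (t - alpha + alpha) with t in F by ring.
    replace (t - alpha + alpha / 2) with (t - alpha / 2) in M by field.
    set (J1 := lsin_int (t - alpha / 2)) in *. set (J0 := lsin_int (t - alpha - alpha / 2)) in *.
    assert (M' : Rabs (J1 / alpha - J0 / alpha - lsin (t - alpha)) <= 12 * alpha ^ 2).
    { replace (J1 / alpha - J0 / alpha - lsin (t - alpha))
        with ((J1 - J0 - 2 * (alpha / 2) * lsin (t - alpha)) / alpha) by (field; lra).
      unfold Rdiv at 1. rewrite Rabs_mult, Rabs_inv, (Rabs_pos_eq alpha) by lra.
      apply Rle_div_l; [lra|]. eapply Rle_trans; [exact M|].
      assert (0 < alpha ^ 3) by (apply pow_lt; lra).
      replace (12 * alpha ^ 2 * alpha) with (12 * alpha ^ 3) by ring.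
      replace (94 * (alpha / 2) ^ 3) with (94 / 8 * alpha ^ 3) by field. lra. }
    apply Rabs_le_between in IH, F, M'. apply Rabs_le. lra.
Qed.

Lemma double_sine_near_5_6 (x : R) : alpha <= 1 / 12 ->
  Rabs (x - 5 / 6) <= 5 / 2 * alpha -> x <= 5 / 6 ->
  Rabs (g (x + alpha) - lsin_int (5 / 6) / alpha) <= 264 * alpha + (2 + / alpha) * eta.
Proof.
  intros H12 Hx Hx2.
  apply Rabs_le_between in Hx.
  set (t := x + alpha).
  destruct (nfloor_ex ((t - (1 + alpha) / 2) / alpha)) as [j Hj].
  { apply Rdiv_le_0_compat; unfold t; lra. }
  assert (Ht : (t - (1 + alpha) / 2) / alpha * alpha = t - (1 + alpha) / 2) by (field; lra).
  assert (B := double_sine_vs_integral j t H12).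
  specialize (B ltac:(split; nra) ltac:(unfold t; lra)).
  assert (Hja : INR j * alpha <= 1) by (unfold t in *; nra).
  assert (Hj' : INR j <= / alpha).
  { apply Rmult_le_reg_r with alpha; [lra|]. rewrite Rinv_l by lra. exact Hja. }
  assert (Q : Rabs (lsin_int (t - alpha / 2) - lsin_int (5 / 6)) <= 216 * alpha ^ 2).
  { assert (Hc : forall c a b, Rabs (c - 5 / 6) <= 3 * alpha -> c <= 11 / 12 ->
       Rabs (b - a) <= 3 * alpha -> Rabs (lsin c * (b - a)) <= 216 * alpha ^ 2).
    { intros c a b Hc Hc2 Hab. assert (Hc' := Hc). apply Rabs_le_between in Hc'.
      assert (Lp := lsin_lipschitz c (5 / 6) ltac:(lra) ltac:(lra)).
      rewrite lsin_5_6, Rminus_0_r in Lp.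
      rewrite Rabs_mult. replace (216 * alpha ^ 2) with (72 * alpha * (3 * alpha)) by ring.
      apply Rmult_le_compat; try apply Rabs_pos; lra. }
    unfold t. destruct (Rle_dec (x + alpha - alpha / 2) (5 / 6)).
    - rewrite Rabs_minus_sym.
      destruct (lsin_int_mvt (x + alpha - alpha / 2) (5 / 6)) as [c [H1 ->]]; try lra.
      apply Hc; [apply Rabs_le; lra|lra|apply Rabs_le; lra].
    - destruct (lsin_int_mvt (5 / 6) (x + alpha - alpha / 2)) as [c [H1 ->]]; try lra.
      apply Hc; [apply Rabs_le; lra|lra|apply Rabs_le; lra]. }
  assert (Q' : Rabs (lsin_int (t - alpha / 2) / alpha - lsin_int (5 / 6) / alpha) <= 216 * alpha).
  { replace (lsin_int (t - alpha / 2) / alpha - lsin_int (5 / 6) / alpha)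
      with ((lsin_int (t - alpha / 2) - lsin_int (5 / 6)) / alpha) by (field; lra).
    unfold Rdiv at 1. rewrite Rabs_mult, Rabs_inv, (Rabs_pos_eq alpha) by lra.
    apply Rle_div_l; [lra|]. nra. }
  assert (INR j * (12 * alpha ^ 2 + eta) <= 12 * alpha + / alpha * eta).
  { assert (INR j * eta <= / alpha * eta) by (apply Rmult_le_compat_r; lra). nra. }
  apply Rabs_le_between in B, Q'. apply Rabs_le. lra.
Qed.

End Level.

Lemma lsin_int_5_6_bounds : 0 <= lsin_int (5 / 6) <= 3.
Proof.
  destruct (lsin_int_mvt (/ 2) (5 / 6)) as [c [Hc E]]; try lra.
  assert (E0 : lsin_int (/ 2) = 0) by apply (@RInt_point R_CompleteNormedModule).
  rewrite E0, Rminus_0_r in E. rewrite E.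
  assert (L0 : 0 <= lsin c).
  { unfold lsin. rewrite <- ln_1. apply ln_le; [lra|].
    assert (HP := PI_RGT_0).
    assert (sin (PI / 6) <= sin (PI * c)); [|rewrite sin_PI6 in *; lra].
    rewrite <- (sin_PI_x (PI * c)). apply sin_incr_1; nra. }
  assert (Lp := lsin_lipschitz c (/ 2) ltac:(lra) ltac:(lra)). rewrite lsin_half in Lp.
  rewrite (Rabs_pos_eq (c - / 2)) in Lp by lra.
  assert (L := ln_2_bounds). apply Rabs_le_between in Lp. split; [nra|].
  assert (lsin c <= 9) by lra. nra.
Qed.

Lemma P_reciprocity_estimate (alpha : R) (n m : nat) :
  irrational alpha -> 0 < alpha < 1 ->
  - (5 / 6 * alpha) <= INR n * alpha - INR m <= 5 / 6 ->
  Rabs (INR n * alpha - INR m - 5 / 6) <= 5 / 2 * alpha ->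
  Rabs (ln (P alpha n) - ln (P (/ alpha) m)
        - (lsin_int (5 / 6) / alpha + / 2 * ln (/ alpha))) <= 600 * alpha.
Proof.
  intros Hi Ha Hx Hx2.
  set (x := INR n * alpha - INR m) in *.
  set (K := 2 + / alpha + / (1 - alpha) + INR (n + m)).
  assert (H1 : 0 < / alpha) by (apply Rinv_0_lt_compat; lra).
  assert (H2 : 0 < / (1 - alpha)) by (apply Rinv_0_lt_compat; lra).
  assert (H3 := pos_INR (n + m)).
  assert (HK : 0 < K) by (unfold K; lra).
  apply le_epsilon. intros eps Heps.
  set (eta := Rmin 1 (eps / (2 * K))).
  assert (He0 : 0 < eta) by (apply Rmin_glb_lt; [lra|apply Rdiv_lt_0_compat; lra]).
  assert (He1 : eta <= 1) by apply Rmin_l.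
  assert (He2 : 2 * K * eta <= eps).
  { assert (eta <= eps / (2 * K)) by apply Rmin_r.
    replace eps with (2 * K * (eps / (2 * K))) by (field; lra).
    apply Rmult_le_compat_l; lra. }
  destruct (approx_double_sine_exists alpha eta ltac:(lra) He0) as [g Hg].
  assert (Ez : INR (S n) * alpha - INR m = x + alpha) by (unfold x; rewrite S_INR; ring).
  assert (W := P_reciprocity alpha eta g n m Hi ltac:(lra) Hg).
  rewrite Ez in W. specialize (W ltac:(lra)).
  assert (A0 := double_sine_at_alpha alpha eta g ltac:(lra) Hg).
  assert (B : Rabs (g (x + alpha) - lsin_int (5 / 6) / alpha)
              <= 600 * alpha + (2 + / alpha + / (1 - alpha)) * eta).
  { destruct (Rle_dec alpha (1 / 12)) as [H12|H12].
    - assert (B := double_sine_near_5_6 alpha eta g Ha (conj He0 He1) Hg x H12 Hx2 ltac:(lra)).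
      nra.
    - assert (B := double_sine_bounded alpha eta g Ha (conj He0 He1) Hg (x + alpha)
                    ltac:(lra) ltac:(lra)).
      assert (BJ := lsin_int_5_6_bounds).
      assert (0 <= lsin_int (5 / 6) / alpha) by (apply Rdiv_le_0_compat; lra).
      assert (lsin_int (5 / 6) / alpha <= 36) by (apply Rle_div_l; lra).
      unfold Rdiv at 1 in B.
      assert (0 < / alpha * eta) by nra.
      apply Rabs_le_between in B. apply Rabs_le. nra. }
  unfold K in He2.
  assert (0 < (/ alpha + / (1 - alpha)) * eta) by nra.
  assert (0 <= INR (n + m) * eta) by nra.
  apply Rabs_le_between in W, A0, B. apply Rabs_le. lra.
Qed.

(** * The volume integral *)

Lemma lsin_int_half : lsin_int (/ 2) = 0.
Proof. apply (@RInt_point R_CompleteNormedModule). Qed.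

Lemma lsin_int_bounded (t : R) : 0 < t <= / 2 -> Rabs (lsin_int t) <= 1.
Proof.
  intros Ht. assert (L := ln_2_bounds). assert (HP := PI_gt_3).
  assert (U : lsin_int (/ 2) - lsin_int t <= 1).
  { destruct (lsin_int_mvt t (/ 2)) as [c [Hc ->]]; try lra.
    assert (lsin c <= ln 2); [|nra].
    unfold lsin. assert (S := sin_PI_pos c ltac:(lra)).
    apply ln_le; [lra|]. assert (B := SIN_bound (PI * c)). lra. }
  assert (W : Lam (/ 2) - Lam t <= lsin_int (/ 2) - lsin_int t).
  { destruct (Req_dec t (/ 2)) as [->|Hn]; [lra|].
    destruct (MVT_gen (fun s => lsin_int s - Lam s) t (/ 2) (fun s => lsin s - ln s)) as [c [Hc E]].
    - intros s; rewrite Rmin_left, Rmax_right by lra; intros Hs.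
      apply (@is_derive_minus R_AbsRing R_NormedModule).
      + apply is_derive_lsin_int; lra.
      + unfold Lam. auto_derive; [lra|field; lra].
    - intros s; rewrite Rmin_left, Rmax_right by lra; intros Hs.
      apply derivable_continuous_pt. exists (lsin s - ln s). apply is_derive_Reals.
      apply (@is_derive_minus R_AbsRing R_NormedModule).
      + apply is_derive_lsin_int; lra.
      + unfold Lam. auto_derive; [lra|field; lra].
    - rewrite Rmin_left, Rmax_right in Hc by lra.
      assert (ln c <= lsin c); [|nra].
      unfold lsin. apply ln_le; [lra|].
      assert (B := sin_ge_half (PI * c) ltac:(nra)). nra. }
  assert (Lt : Lam t <= 0).
  { unfold Lam. assert (ln t <= 0); [|nra]. rewrite <- ln_1. apply ln_le; lra. }
  assert (Lh : -1 <= Lam (/ 2)).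
  { unfold Lam. rewrite ln_Rinv by lra. lra. }
  rewrite lsin_int_half in *. apply Rabs_le. lra.
Qed.

Lemma lsin_int_double (t : R) : 0 < t < 1 ->
  lsin_int t = 2 * lsin_int (t / 2) - 2 * lsin_int (1 / 2 - t / 2).
Proof.
  intros Ht.
  set (psi := fun s => 2 * lsin_int (s / 2) - 2 * lsin_int (1 / 2 - s / 2) - lsin_int s).
  assert (Hd : forall s, 0 < s < 1 -> is_derive psi s 0).
  { intros s Hs. unfold psi.
    assert (D1 := is_derive_lsin_int (s / 2) ltac:(lra)).
    assert (D2 := is_derive_lsin_int (1 / 2 - s / 2) ltac:(lra)).
    assert (D3 := is_derive_lsin_int s Hs).
    auto_derive.
    - repeat split; eexists; eassumption.
    - assert (E1 : Derive (fun x => lsin_int x) (s * / 2) = lsin (s / 2)) by exact (is_derive_unique _ _ _ D1).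
      assert (E2 : Derive (fun x => lsin_int x) (1 / 2 + - (s * / 2)) = lsin (1 / 2 - s / 2))
        by exact (is_derive_unique _ _ _ D2).
      assert (E3 : Derive (fun x => lsin_int x) s = lsin s) by exact (is_derive_unique _ _ _ D3).
      rewrite E1, E2, E3, (lsin_double s Hs). field. }
  assert (E : psi t - psi (/ 2) = 0).
  { destruct (MVT_gen psi (/ 2) t (fun _ => 0)) as [c [Hc ->]]; [| |ring].
    - intros s Hs. apply Hd. split.
      + apply Rlt_trans with (Rmin (/ 2) t); [apply Rmin_glb_lt|]; lra.
      + apply Rlt_trans with (Rmax (/ 2) t); [|apply Rmax_lub_lt]; lra.
    - intros s Hs. apply derivable_continuous_pt. exists 0. apply is_derive_Reals, Hd. split.
      + apply Rlt_le_trans with (Rmin (/ 2) t); [apply Rmin_glb_lt|]; lra.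
      + apply Rle_lt_trans with (Rmax (/ 2) t); [|apply Rmax_lub_lt]; lra. }
  unfold psi in E. rewrite lsin_int_half in E.
  replace (1 / 2 - / 2 / 2) with (/ 2 / 2) in E by field. lra.
Qed.

(* [L (t / 2) = L t / 2 + O (t)] forces [L t -> 0], i.e. the integral of [lsin] over [(0, 1/2)] vanishes. *)
Lemma lsin_int_small (k : nat) (t : R) :
  0 < t <= / 4 * (/ 2) ^ k -> Rabs (lsin_int t) <= (3 / 4) ^ k.
Proof.
  revert t. induction k as [|k IH]; intros t Ht.
  - simpl in *. apply lsin_int_bounded; lra.
  - assert (Hp : (/ 2) ^ k <= (3 / 4) ^ k) by (apply pow_incr; lra).
    assert (Hp1 : (/ 2) ^ k <= 1 ^ k) by (apply pow_incr; lra). rewrite pow1 in Hp1.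
    simpl pow in *. specialize (IH (2 * t) ltac:(lra)).
    assert (E := lsin_int_double (2 * t) ltac:(lra)).
    replace (2 * t / 2) with t in E by field.
    assert (B : Rabs (lsin_int (1 / 2 - t)) <= t).
    { destruct (lsin_int_mvt (1 / 2 - t) (/ 2)) as [c [Hc E']]; try lra.
      rewrite lsin_int_half in E'.
      assert (L := ln_2_bounds).
      assert (U : 0 <= lsin c <= 1).
      { unfold lsin. assert (HP := PI_gt_3).
        assert (B := sin_ge_cubic (PI / 6) ltac:(lra)).
        assert (S : sin (PI / 6) <= sin (PI * c)) by (apply sin_incr_1; nra).
        rewrite sin_PI6 in S. split.
        - rewrite <- ln_1. apply ln_le; lra.
        - apply Rle_trans with (ln 2); [|lra]. apply ln_le; [lra|].
          assert (B' := SIN_bound (PI * c)). lra. }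
      replace (lsin_int (1 / 2 - t)) with (- (lsin c * t)) by (replace t with (/ 2 - (1 / 2 - t)) at 1 by field; lra).
      rewrite Rabs_Ropp, Rabs_pos_eq by nra. nra. }
    apply Rabs_le_between in IH, B. apply Rabs_le. lra.
Qed.

Lemma is_RInt_gen_lsin : is_RInt_gen lsin (at_right 0) (at_point (5 / 6)) (lsin_int (5 / 6)).
Proof.
  intros Q [eps HQ].
  destruct (pow_lt_1_zero (3 / 4) ltac:(rewrite Rabs_pos_eq; lra) eps (cond_pos eps)) as [k Hk].
  specialize (Hk k ltac:(lia)).
  assert (Hd : 0 < / 4 * (/ 2) ^ k) by (assert (0 < (/ 2) ^ k) by (apply pow_lt; lra); lra).
  assert (Hp1 : (/ 2) ^ k <= 1 ^ k) by (apply pow_incr; lra). rewrite pow1 in Hp1.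
  apply (Filter_prod _ _ _ (fun a => 0 < a < / 4 * (/ 2) ^ k) (fun b => b = 5 / 6)).
  - exists (mkposreal _ Hd). intros a Ha Ha0.
    unfold ball in Ha; simpl in Ha; unfold AbsRing_ball, abs, minus, plus, opp in Ha; simpl in Ha.
    rewrite Ropp_0, Rplus_0_r in Ha. apply Rabs_def2 in Ha. lra.
  - reflexivity.
  - intros a b Ha ->. simpl.
    exists (lsin_int (5 / 6) - lsin_int a). split.
    + assert (H1 : is_RInt lsin a (/ 2) (opp (lsin_int a))).
      { apply (@is_RInt_swap R_NormedModule).
        apply (@RInt_correct R_CompleteNormedModule), ex_RInt_lsin; lra. }
      assert (H2 : is_RInt lsin (/ 2) (5 / 6) (lsin_int (5 / 6))).
      { apply (@RInt_correct R_CompleteNormedModule), ex_RInt_lsin; lra. }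
      assert (H3 := @is_RInt_Chasles R_NormedModule _ _ _ _ _ _ H1 H2).
      replace (lsin_int (5 / 6) - lsin_int a) with (plus (opp (lsin_int a)) (lsin_int (5 / 6))).
      * exact H3.
      * unfold plus, opp; simpl; ring.
    + apply HQ. unfold ball; simpl; unfold AbsRing_ball, abs, minus, plus, opp; simpl.
      replace (lsin_int (5 / 6) - lsin_int a + - lsin_int (5 / 6)) with (- lsin_int a) by ring.
      rewrite Rabs_Ropp. assert (B := lsin_int_small k a ltac:(lra)).
      rewrite Rabs_pos_eq in Hk by (apply pow_le; lra). lra.
Qed.

Lemma Vol41_div_4PI : Vol41 / (4 * PI) = lsin_int (5 / 6).
Proof.
  unfold Vol41. change (fun x => ln (2 * sin (PI * x))) with lsin.
  rewrite (is_RInt_gen_unique _ _ is_RInt_gen_lsin).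
  assert (HP := PI_RGT_0). field; lra.
Qed.

(** * Iteration along the continued fraction *)

Lemma irrational_fracR (x : R) : irrational x -> irrational (fracR x).
Proof.
  intros Hi p q Hq E. apply (Hi (p + Int_part x * q)%Z q Hq).
  assert (Hq' : IZR q <> 0) by (intros H; apply Hq; now apply eq_IZR).
  unfold fracR in E. rewrite plus_IZR, mult_IZR.
  replace x with (IZR p / IZR q + IZR (Int_part x)) at 1 by lra. field; auto.
Qed.

Lemma fracR_bounds (x : R) : irrational x -> 0 < fracR x < 1.
Proof.
  intros Hi. assert (B := base_Int_part x).
  assert (fracR x <> 0).
  { intros E. apply (irrational_fracR x Hi 0%Z 1%Z); [lia|]. rewrite E; field. }
  unfold fracR in *. lra.
Qed.

Lemma cf_rem_irrational (x : R) (k : nat) : irrational x -> irrational (cf_rem x k).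
Proof.
  intros Hi. induction k as [|k IH]; simpl; apply irrational_fracR; [exact Hi|].
  now apply irrational_inv.
Qed.

Lemma cf_rem_bounds (x : R) (k : nat) : irrational x -> 0 < cf_rem x k < 1.
Proof.
  intros Hi. destruct k as [|k]; simpl; apply fracR_bounds; [exact Hi|].
  now apply irrational_inv, cf_rem_irrational.
Qed.

Lemma cf_rem_inv (x : R) (k : nat) : irrational x ->
  / cf_rem x k = cf_rem x (S k) + IZR (Z.of_nat (cf_a x (S k))) /\ (1 <= cf_a x (S k))%nat.
Proof.
  intros Hi. assert (Hr := cf_rem_bounds x k Hi).
  assert (H1 : 1 < / cf_rem x k) by (rewrite <- Rinv_1; apply Rinv_lt_contravar; lra).
  assert (B := base_Int_part (/ cf_rem x k)).
  assert (Hz : (0 < Int_part (/ cf_rem x k))%Z) by (apply lt_IZR; simpl; lra).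
  simpl. split; [|lia].
  rewrite Z2Nat.id by lia. unfold fracR. ring.
Qed.

Lemma cf_q_pair_snd (x : R) (k : nat) : snd (cf_q_pair x k) = cf_q x (S k).
Proof. unfold cf_q. simpl. now destruct (cf_q_pair x k). Qed.

Lemma cf_q_SS (x : R) (k : nat) :
  cf_q x (S (S k)) = (cf_a x (S (S k)) * cf_q x (S k) + cf_q x k)%nat.
Proof.
  rewrite <- cf_q_pair_snd, <- (cf_q_pair_snd x k). unfold cf_q.
  simpl. now destruct (cf_q_pair x k).
Qed.

(* [Nstar_tail x s d] is the number built like [Nstar] from the [d] partial quotients following [a_s],
   i.e. with the denominators of the continued fraction of the remainder [cf_rem x s]. *)
Fixpoint Nstar_tail (x : R) (s d : nat) : nat :=
  match d with
  | O => O
  | S d1 => (5 * cf_a x (S s) / 6 + cf_a x (S s) * Nstar_tail x (S s) d1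
             + match d1 with O => O | S d2 => Nstar_tail x (S (S s)) d2 end)%nat
  end.

Lemma Nstar_tail_S (x : R) (s d : nat) :
  Nstar_tail x s (S d) = (5 * cf_a x (S s) / 6 + cf_a x (S s) * Nstar_tail x (S s) d
    + Nstar_tail x (S (S s)) (pred d))%nat.
Proof. now destruct d. Qed.

Lemma Nstar_split (x : R) (s d : nat) :
  Nstar_tail x 0 (s + d) = (Nstar x s + cf_q x s * Nstar_tail x s d
    + match s with O => O | S s' => cf_q x s' end * Nstar_tail x (S s) (pred d))%nat.
Proof.
  revert d. induction s as [|s IH]; intros d.
  - cbn -[Nstar_tail]. lia.
  - replace (S s + d)%nat with (s + S d)%nat by lia.
    rewrite IH, Nstar_tail_S. simpl pred.
    change (Nstar x (S s)) with (Nstar x s + 5 * cf_a x (S s) / 6 * cf_q x s)%nat.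
    destruct s as [|s].
    + change (cf_q x 1) with (cf_a x 1). change (cf_q x 0) with 1%nat. lia.
    + rewrite (cf_q_SS x s). ring.
Qed.

Lemma Nstar_tail_0 (x : R) (K : nat) : Nstar_tail x 0 K = Nstar x K.
Proof.
  assert (H := Nstar_split x K 0). rewrite Nat.add_0_r in H. rewrite H. simpl; lia.
Qed.

Lemma div_5_6_bounds (a : nat) :
  5 / 6 * INR a - 5 / 6 <= INR (5 * a / 6) <= 5 / 6 * INR a.
Proof.
  assert (E := Nat.div_mod (5 * a) 6 ltac:(lia)).
  assert (M := Nat.mod_upper_bound (5 * a) 6 ltac:(lia)).
  apply (f_equal INR) in E. rewrite plus_INR, !mult_INR in E.
  assert (M' : INR ((5 * a) mod 6) <= INR 5) by (apply le_INR; lia).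
  assert (M0 := pos_INR ((5 * a) mod 6)).
  simpl (INR 5) in *. simpl (INR 6) in *. lra.
Qed.

Definition cf_offset (x : R) (s d : nat) : R :=
  INR (Nstar_tail x s d) * cf_rem x s - INR (Nstar_tail x (S s) (pred d)).

Lemma cf_offset_S (x : R) (s d : nat) : irrational x ->
  cf_offset x s (S d) = cf_rem x s * (INR (5 * cf_a x (S s) / 6) - cf_offset x (S s) d).
Proof.
  intros Hi. assert (Hr := cf_rem_bounds x s Hi).
  destruct (cf_rem_inv x s Hi) as [E _]. rewrite <- INR_IZR_INZ in E.
  unfold cf_offset. rewrite Nstar_tail_S. simpl pred.
  rewrite !plus_INR, mult_INR.
  replace (INR (cf_a x (S s))) with (/ cf_rem x s - cf_rem x (S s)) by lra.
  field; lra.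
Qed.

Lemma cf_offset_bounds (x : R) (s d : nat) : irrational x ->
  - (5 / 6 * cf_rem x s) <= cf_offset x s d <= 5 / 6.
Proof.
  intros Hi. revert s. induction d as [|d IH]; intros s; assert (Hr := cf_rem_bounds x s Hi).
  - unfold cf_offset. simpl. lra.
  - rewrite cf_offset_S by auto. specialize (IH (S s)).
    assert (Hr' := cf_rem_bounds x (S s) Hi).
    destruct (cf_rem_inv x s Hi) as [E _]. rewrite <- INR_IZR_INZ in E.
    assert (B := div_5_6_bounds (cf_a x (S s))).
    assert (E' : cf_rem x s * (cf_rem x (S s) + INR (cf_a x (S s))) = 1) by (rewrite <- E; field; lra).
    assert (0 <= INR (5 * cf_a x (S s) / 6)) by apply pos_INR.
    split; nra.
Qed.

Lemma cf_offset_near (x : R) (s d : nat) : irrational x ->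
  Rabs (cf_offset x s (S d) - 5 / 6) <= 5 / 2 * cf_rem x s.
Proof.
  intros Hi. assert (U := cf_offset_bounds x s (S d) Hi).
  assert (Hr := cf_rem_bounds x s Hi). assert (Hr' := cf_rem_bounds x (S s) Hi).
  assert (IH := cf_offset_bounds x (S s) d Hi).
  rewrite cf_offset_S in * by auto.
  destruct (cf_rem_inv x s Hi) as [E _]. rewrite <- INR_IZR_INZ in E.
  assert (B := div_5_6_bounds (cf_a x (S s))).
  assert (E' : cf_rem x s * (cf_rem x (S s) + INR (cf_a x (S s))) = 1) by (rewrite <- E; field; lra).
  assert (cf_rem x s * (5 / 6 * INR (cf_a x (S s)) - 5 / 3)
    <= cf_rem x s * (INR (5 * cf_a x (S s) / 6) - cf_offset x (S s) d))
    by (apply Rmult_le_compat_l; lra).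
  apply Rabs_le. nra.
Qed.

Lemma P_level_estimate (x : R) (s d : nat) : irrational x ->
  Rabs (ln (P (cf_rem x s) (Nstar_tail x s (S d)))
        - ln (P (cf_rem x (S s)) (Nstar_tail x (S s) d))
        - (lsin_int (5 / 6) * INR (cf_a x (S s)) + / 2 * ln (INR (cf_a x (S s)))))
  <= 601 * (/ INR (cf_a x (S s)) + / INR (cf_a x (S (S s)))).
Proof.
  intros Hi.
  assert (Hr := cf_rem_bounds x s Hi). assert (Hr' := cf_rem_bounds x (S s) Hi).
  assert (Hr'' := cf_rem_bounds x (S (S s)) Hi).
  assert (B := P_reciprocity_estimate (cf_rem x s) (Nstar_tail x s (S d)) (Nstar_tail x (S s) d)
     (cf_rem_irrational x s Hi) Hr (cf_offset_bounds x s (S d) Hi) (cf_offset_near x s d Hi)).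
  destruct (cf_rem_inv x s Hi) as [E Ha]. destruct (cf_rem_inv x (S s) Hi) as [E' Ha'].
  unfold Rdiv in B. rewrite E, P_shift in B. rewrite <- INR_IZR_INZ in *.
  set (a := cf_a x (S s)) in *. set (a' := cf_a x (S (S s))) in *.
  apply (le_INR 1) in Ha, Ha'. simpl in Ha, Ha'.
  assert (R1 : cf_rem x s <= / INR a).
  { rewrite <- (Rinv_inv (cf_rem x s)), E. apply Rinv_le_contravar; lra. }
  assert (R2 : cf_rem x (S s) <= / INR a').
  { rewrite <- (Rinv_inv (cf_rem x (S s))), E'. apply Rinv_le_contravar; lra. }
  set (r' := cf_rem x (S s)) in *.
  assert (Ha0 : 0 < / INR a) by (apply Rinv_0_lt_compat; lra).
  assert (L : 0 <= ln (r' + INR a) - ln (INR a) <= / INR a).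
  { split; [assert (ln (INR a) <= ln (r' + INR a)) by (apply ln_le; lra); lra|].
    replace (r' + INR a) with (INR a * (1 + r' * / INR a)) by (field; lra).
    assert (0 <= r' * / INR a <= / INR a) by nra.
    rewrite ln_mult by lra.
    assert (U := ln1p_le (r' * / INR a) ltac:(lra)). lra. }
  assert (BJ := lsin_int_5_6_bounds). change (5 * / 6) with (5 / 6) in B.
  apply Rabs_le_between in B. apply Rabs_le. nra.
Qed.

Lemma P_tail_estimate (x : R) (s d : nat) : irrational x ->
  Rabs (ln (P (cf_rem x s) (Nstar_tail x s d))
        - sumR 0 d (fun k => lsin_int (5 / 6) * INR (cf_a x (S (s + k)))
                             + / 2 * ln (INR (cf_a x (S (s + k))))))
  <= sumR 0 d (fun k => 601 * (/ INR (cf_a x (S (s + k))) + / INR (cf_a x (S (S (s + k)))))).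
Proof.
  intros Hi. revert s. induction d as [|d IH]; intros s.
  - simpl. rewrite ln_1, Rminus_diag, Rabs_R0. lra.
  - rewrite !sumR_first, Nat.add_0_r.
    rewrite (sumR_ext d _ (fun k => lsin_int (5 / 6) * INR (cf_a x (S (S s + k)))
                             + / 2 * ln (INR (cf_a x (S (S s + k))))))
      by (intros k _; now rewrite Nat.add_succ_r).
    rewrite (sumR_ext d (fun k => 601 * _)
      (fun k => 601 * (/ INR (cf_a x (S (S s + k))) + / INR (cf_a x (S (S (S s + k)))))))
      by (intros k _; now rewrite Nat.add_succ_r).
    assert (B := P_level_estimate x s d Hi). specialize (IH (S s)).
    apply Rabs_le_between in B, IH. apply Rabs_le. lra.
Qed.

Theorem theorem3 :
  forall T : R, 1 <= T ->
  exists C : R, 0 <= C /\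
  forall (alpha : R) (k0 : nat),
    irrational alpha -> (1 <= k0)%nat ->
    (forall k : nat, (k0 <= k)%nat ->
       ln (INR (cf_a alpha k)) / INR (cf_a alpha (S k)) <= T) ->
    exists D : R,
    forall K : nat,
      Rabs (ln (P alpha (Nstar alpha K))
            - (Vol41 / (4 * PI) * sumR 1 (S K) (fun k => INR (cf_a alpha k))
               + / 2 * sumR 1 (S K) (fun k => ln (INR (cf_a alpha k)))))
      <= C * sumR 1 (S K) (fun k =>
               (1 + ln (INR (cf_a alpha k) * INR (cf_a alpha (S k))))
               / INR (cf_a alpha (S k))) + D.
Proof.
  intros T _. exists 1202. split; [lra|].
  intros alpha k0 Hi _ _. exists 601. intros K.
  rewrite !sumR_1_S, Vol41_div_4PI, <- !sumR_scal, <- sumR_plus.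
  assert (EP : P alpha (Nstar alpha K) = P (cf_rem alpha 0) (Nstar alpha K)).
  { rewrite <- (P_shift (cf_rem alpha 0) (Int_part alpha)). f_equal. simpl. unfold fracR. ring. }
  rewrite EP, <- Nstar_tail_0.
  assert (Ha : forall k, 1 <= INR (cf_a alpha (S k))).
  { intros k. apply (le_INR 1), cf_rem_inv, Hi. }
  set (u := fun k => / INR (cf_a alpha (S k))).
  apply Rle_trans with (sumR 0 K (fun k => 601 * (u k + u (S k)))).
  { exact (P_tail_estimate alpha 0 K Hi). }
  assert (Hu : forall k, 0 < u k <= 1).
  { intros k. specialize (Ha k). unfold u. split; [apply Rinv_0_lt_compat; lra|].
    rewrite <- Rinv_1. apply Rinv_le_contravar; lra. }
  assert (E : sumR 0 K u + u K = u O + sumR 0 K (fun k => u (S k)))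
    by (rewrite <- sumR_S; apply sumR_first).
  assert (L : sumR 0 K (fun k => u (S k)) <= sumR 0 K (fun k =>
     (1 + ln (INR (cf_a alpha (S k)) * INR (cf_a alpha (S (S k))))) / INR (cf_a alpha (S (S k))))).
  { apply sumR_le. intros k _. unfold u, Rdiv.
    rewrite <- (Rmult_1_l (/ _)) at 1.
    apply Rmult_le_compat_r; [left; apply Rinv_0_lt_compat; specialize (Ha (S k)); lra|].
    assert (H1 := Ha k). assert (H2 := Ha (S k)).
    assert (0 <= ln (INR (cf_a alpha (S k)) * INR (cf_a alpha (S (S k))))); [|lra].
    rewrite <- ln_1. apply ln_le; nra. }
  rewrite !sumR_scal, (sumR_plus K u (fun k => u (S k))).
  cbv beta. assert (H0 := Hu O). assert (HK := Hu K). lra.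
Qed.
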